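(* A minimum consistent subset of $n$ colored points on two parallel lines can be computed in $O(n^6)$ time.
   Context: The input is a set of $n$ points in $\mathbb{R}^2$, each assigned one color (the number of colors is arbitrary), such that every point lies on one of two given parallel straight lines. A subset $S$ of a colored point set $X$ is a consistent subset of $X$ if for every point $p\in X\setminus S$, the closest point of $p$ in $S$ (in Euclidean distance) has the same color as $p$. A minimum consistent subset is a consistent subset of minimum cardinality. Running times are in the standard real-RAM model of computational geometry. *)

(* Defs.v *)
(* MathComp / MathComp-Analysis development. *)
From HB Require Import structures.
From mathcomp Require Import all_boot all_order all_algebra.
From mathcomp Require Import all_classical all_reals all_analysis.

Set Implicit Arguments.
Unset Strict Implicit.
Unset Printing Implicit Defensive.

Import Order.TTheory GRing.Theory Num.Theory.
Import numFieldNormedType.Exports.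

Local Open Scope ring_scope.

(* The sup-norm distance that the library puts on R * R is not the Euclidean
   one, hence this definition. *)
Definition edist (R : realType) (p q : R * R) : R :=
  Num.sqrt ((p.1 - q.1) ^+ 2 + (p.2 - q.2) ^+ 2).

(* The lines are nx * x + ny * y = off1 and nx * x + ny * y = off2.  Colors are
   arbitrary natural numbers, so their number is unrestricted. *)
Record instance (R : realType) (n : nat) := Instance {
  pos : 'I_n -> R * R;
  color : 'I_n -> nat;
  nx : R;
  ny : R;
  off1 : R;
  off2 : R
}.

Definition on_two_parallel_lines (R : realType) n (I : instance R n) : Prop :=
  [/\ injective (pos I),
      (nx I, ny I) != (0, 0),
      off1 I != off2 I
    & forall i, nx I * (pos I i).1 + ny I * (pos I i).2 = off1 I \/
                nx I * (pos I i).1 + ny I * (pos I i).2 = off2 I].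

Definition closest (R : realType) n (I : instance R n) (S : {set 'I_n})
    (p s : 'I_n) : Prop :=
  s \in S /\
  forall t, t \in S -> edist (pos I p) (pos I s) <= edist (pos I p) (pos I t).

(* If several points of S are at minimum distance from p, one of them must have
   the color of p.  The empty set is consistent only when n = 0. *)
Definition consistent (R : realType) n (I : instance R n) (S : {set 'I_n}) :
    Prop :=
  forall p, p \notin S -> exists2 s, closest I S p s & color I s = color I p.

Definition minimum_consistent (R : realType) n (I : instance R n)
    (S : {set 'I_n}) : Prop :=
  consistent I S /\ forall S', consistent I S' -> (#|S| <= #|S'|)%N.

(* Real RAM.  The memory consists of natural-number cells (indices, addresses,
   colors) and real cells, both indexed by nat.  Every instruction has unit
   cost.  Real cells support field operations and comparison only: there is
   neither a root extraction nor a floor, nor any other way to turn a real into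
   a natural number except by branching.  Programs contain no real constants;
   they mention natural numbers only.  Subtraction of natural numbers is
   truncated, and division by zero yields zero. *)
Inductive nat_op := NAdd | NSub | NMul.
Inductive real_op := RAdd | RSub | RMul | RDiv.

Inductive instr :=
| NConst (d k : nat)               (* N[d] := k *)
| NOp (o : nat_op) (d a b : nat)   (* N[d] := N[a] o N[b] *)
| NLoad (d a : nat)                (* N[d] := N[N[a]] *)
| NStore (a b : nat)               (* N[N[a]] := N[b] *)
| ROfNat (d a : nat)               (* R[d] := N[a] *)
| ROp (o : real_op) (d a b : nat)  (* R[d] := R[a] o R[b] *)
| RLoad (d a : nat)                (* R[d] := R[N[a]] *)
| RStore (a b : nat)               (* R[N[a]] := R[b] *)
| NJumpLe (a b l : nat)            (* if N[a] <= N[b] goto l *)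
| RJumpLe (a b l : nat).           (* if R[a] <= R[b] goto l *)

Definition program := seq instr.

Record state (R : realType) := State {
  pc : nat;
  nmem : nat -> nat;
  rmem : nat -> R
}.

Definition eval_nat_op (o : nat_op) : nat -> nat -> nat :=
  match o with NAdd => addn | NSub => subn | NMul => muln end.

Definition eval_real_op (R : realType) (o : real_op) (x y : R) : R :=
  match o with
  | RAdd => x + y | RSub => x - y | RMul => x * y | RDiv => x / y
  end.

Definition exec (R : realType) (c : instr) (s : state R) : state R :=
  let: State k N M := s in
  match c with
  | NConst d v => State k.+1 [eta N with d |-> v] M
  | NOp o d a b => State k.+1 [eta N with d |-> eval_nat_op o (N a) (N b)] M
  | NLoad d a => State k.+1 [eta N with d |-> N (N a)] M
  | NStore a b => State k.+1 [eta N with N a |-> N b] M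
  | ROfNat d a => State k.+1 N [eta M with d |-> (N a)%:R]
  | ROp o d a b => State k.+1 N [eta M with d |-> eval_real_op o (M a) (M b)]
  | RLoad d a => State k.+1 N [eta M with d |-> M (N a)]
  | RStore a b => State k.+1 N [eta M with N a |-> M b]
  | NJumpLe a b l => State (if (N a <= N b)%N then l else k.+1) N M
  | RJumpLe a b l => State (if M a <= M b then l else k.+1) N M
  end.

Definition halted (R : realType) (P : program) (s : state R) : bool :=
  (size P <= pc s)%N.

(* A halted state is left unchanged. *)
Definition step (R : realType) (P : program) (s : state R) : state R :=
  oapp (fun c => exec c s) s (onth P (pc s)).

(* N[0] = n and N[i + 1] = color of point i;
   R[0], R[1], R[2], R[3] = nx, ny, off1, off2 and
   R[4 + 2 i], R[5 + 2 i] = coordinates of point i;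
   every other cell is 0. *)
Definition initial (R : realType) n (I : instance R n) : state R :=
  State 0
    (fun k => match k with
              | 0 => n
              | k'.+1 => oapp (color I) 0%N (insub k')
              end)
    (fun k => match k with
              | 0 => nx I
              | 1 => ny I
              | 2 => off1 I
              | 3 => off2 I
              | k'.+4 => oapp (fun i => if odd k' then (pos I i).2
                                        else (pos I i).1) 0 (insub k'./2)
              end).

(* Upon termination, point i is selected when N[i + 1] is nonzero. *)
Definition output (R : realType) n (s : state R) : {set 'I_n} :=
  [set i : 'I_n | nmem s i.+1 != 0%N].

(* The machine has halted after at most t instructions, with output in Q. *)
Definition computes_within (R : realType) n (P : program) (I : instance R n)
    (t : nat) (Q : {set 'I_n} -> Prop) : Prop :=
  let s := iter t (step P) (initial I) in
  halted P s /\ Q (output n s).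

(* Main.v *)
(* Why O(n^6).  Order the points by their coordinate along the lines.  The
   squared distance is then a function of that coordinate plus a term that
   depends only on the lines involved, so among the selected points of one line
   only the last one before p and the first one after p can be closest to p.
   Whether p is served thus depends on four selected points (a, a') and (b, b'):
   its neighbors on either line.  A sweep over the points guesses these
   quadruples: when the sweep reaches a' it selects that point and guesses its
   successor x on the same line, and at every other point it checks that the
   four neighbors serve it.  The table of the least numbers of selections over
   all positions and quadruples has O(n^5) cells, and each is a minimum over the
   O(n) choices of x.

   Machine programs come from a small structured language with arrays whose
   only loops run up to n or n + 1; the number of machine steps is then a
   syntactic polynomial of degree the nesting depth of loops, which is 6. *)

Require Import Defs.
From HB Require Import structures.
From mathcomp Require Import all_boot all_order all_algebra.
From mathcomp Require Import all_classical all_reals all_analysis.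
From mathcomp Require Import zify ring lra.
Import Order.TTheory GRing.Theory Num.Theory.
Import numFieldNormedType.Exports.

Set Implicit Arguments.
Unset Strict Implicit.
Unset Printing Implicit Defensive.

Local Open Scope ring_scope.
Local Open Scope nat_scope.

(** * Structured machine code *)

(** Call the sequence of quadruples induced by a subset its trail. The trail of a consistent subset
    is a legal run of the sweep, so the table bounds its size from below. Conversely, every run of
    finite cost is the trail of the subset it selects: a wrong guess, be it on the wrong line or
    already passed, is never met by the sweep, stays pending until the end and is rejected there.
    Hence a guess needs no check when it is made. The machine has no square roots and the normal
    vector need not have length 1. Points are therefore replaced by their dot and cross products
    with that vector, which multiplies all distances by one factor, and squared distances are
    compared. The other obstacle is the memory: every low cell may hold input, so no register is
    free at the start. A base address beyond the input has to be computed in place, and the input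
    moved there, before compiled code can run; at the end the output has to return to the cells that
    served as registers. *)

Variant test := NLe of nat & nat | RLe of nat & nat.

Inductive cmd :=
| Skip
| Prim of instr
| Seq of cmd & cmd
| Ifte of test & cmd & cmd
| While of nat & nat & cmd.

Definition jump (t : test) (l : nat) : instr :=
  match t with NLe a b => NJumpLe a b l | RLe a b => RJumpLe a b l end.

Definition is_jump (i : instr) : bool :=
  match i with NJumpLe _ _ _ | RJumpLe _ _ _ => true | _ => false end.

Fixpoint clen (c : cmd) : nat :=
  match c with
  | Skip => 0
  | Prim _ => 1
  | Seq c1 c2 => clen c1 + clen c2
  | Ifte _ c1 c2 => clen c1 + clen c2 + 2
  | While _ _ c => clen c + 2
  end.

(** Jump targets are absolute, hence the offset [o]. A test jumps only when it succeeds, so the else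
    branch is laid out first; [NJumpLe 0 0] always succeeds and acts as the unconditional jump. *)
Fixpoint code (o : nat) (c : cmd) : program :=
  match c with
  | Skip => [::]
  | Prim i => [:: i]
  | Seq c1 c2 => code o c1 ++ code (o + clen c1) c2
  | Ifte t c1 c2 =>
      jump t (o + clen c2 + 2) :: code o.+1 c2 ++
      NJumpLe 0 0 (o + clen c2 + 2 + clen c1) :: code (o + clen c2 + 2) c1
  | While a b c =>
      NJumpLe b a (o + clen c + 2) :: code o.+1 c ++ [:: NJumpLe 0 0 o]
  end.

Lemma size_code o c : size (code o c) = clen c.
Proof.
elim: c o => [|i|c1 IH1 c2 IH2|t c1 IH1 c2 IH2|a b c IH] o //=.
- by rewrite size_cat IH1 IH2.
- by rewrite size_cat /= IH1 IH2; lia.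
- by rewrite size_cat /= IH; lia.
Qed.

(** The parameter [k] bounds the iterations of every loop. Adding both branches of a conditional,
    instead of taking the larger, keeps this a polynomial in [k] read off the syntax. *)
Fixpoint time (k : nat) (c : cmd) : nat :=
  match c with
  | Skip => 0
  | Prim _ => 1
  | Seq c1 c2 => time k c1 + time k c2
  | Ifte _ c1 c2 => time k c1 + time k c2 + 2
  | While _ _ c => k * (time k c + 2) + 1
  end.

Fixpoint nesting (c : cmd) : nat :=
  match c with
  | Skip | Prim _ => 0
  | Seq c1 c2 | Ifte _ c1 c2 => maxn (nesting c1) (nesting c2)
  | While _ _ c => (nesting c).+1
  end.

Fixpoint weight (c : cmd) : nat :=
  match c with
  | Skip => 0
  | Prim _ => 1
  | Seq c1 c2 => weight c1 + weight c2
  | Ifte _ c1 c2 => weight c1 + weight c2 + 2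
  | While _ _ c => weight c + 3
  end.

Lemma time_le k c : 0 < k -> time k c <= weight c * k ^ nesting c.
Proof.
move=> k0; have kX a b : a <= b -> k ^ a <= k ^ b by exact: leq_pexp2l.
have kXn a : 0 < k ^ a by rewrite expn_gt0 k0.
elim: c => [|i|c1 IH1 c2 IH2|t c1 IH1 c2 IH2|a b c IH] //=.
- have := kX _ _ (leq_maxl (nesting c1) (nesting c2)).
  have := kX _ _ (leq_maxr (nesting c1) (nesting c2)); nia.
- have := kX _ _ (leq_maxl (nesting c1) (nesting c2)).
  have := kX _ _ (leq_maxr (nesting c1) (nesting c2)).
  have := kXn (maxn (nesting c1) (nesting c2)); nia.
- rewrite expnS; have := kXn (nesting c).
  set X := k ^ _ in IH *; nia.
Qed.

(** * Total correctness with step counts *)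

Section Wp.
Variable R : realType.

Definition mem := ((nat -> nat) * (nat -> R))%type.

Definition at_pc (k : nat) (m : mem) : state R := State k m.1 m.2.

Definition exec_prim (i : instr) (m : mem) : mem :=
  let s := exec i (at_pc 0 m) in (nmem s, rmem s).

Definition holds (t : test) (m : mem) : bool :=
  match t with NLe a b => m.1 a <= m.1 b | RLe a b => (m.2 a <= m.2 b)%R end.

Definition placed (P s : program) (o : nat) : Prop :=
  exists pre post, P = pre ++ s ++ post /\ size pre = o.

Lemma placed_cat P s1 s2 o :
  placed P (s1 ++ s2) o -> placed P s1 o /\ placed P s2 (o + size s1).
Proof.
move=> [pre [post [-> <-]]]; split.
  by exists pre, (s2 ++ post); split; rewrite -?catA.
by exists (pre ++ s1), post; split; rewrite ?size_cat -?catA.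
Qed.

Lemma placed_cons P i s o :
  placed P (i :: s) o -> onth P o = Some i /\ placed P s o.+1.
Proof.
move=> [pre [post [-> <-]]]; split.
  by rewrite onth_cat ltnn subnn.
by exists (rcons pre i), post; split; rewrite ?cat_rcons ?size_rcons.
Qed.

Definition reaches P t (s s' : state R) : Prop := iter t (step P) s = s'.

Lemma reaches_trans P t1 t2 s1 s2 s3 :
  reaches P t1 s1 s2 -> reaches P t2 s2 s3 -> reaches P (t1 + t2) s1 s3.
Proof. by move=> <- <-; rewrite /reaches addnC iterD. Qed.

Lemma reaches1 P i o (m : mem) :
  onth P o = Some i -> reaches P 1 (at_pc o m) (exec i (at_pc o m)).
Proof. by move=> Pi; rewrite /reaches /= /step /= Pi. Qed.

Lemma exec_jump t l o m :
  exec (jump t l) (at_pc o m) = at_pc (if holds t m then l else o.+1) m.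
Proof. by case: t. Qed.

Lemma exec_primE i o m : ~~ is_jump i ->
  exec i (at_pc o m) = at_pc o.+1 (exec_prim i m).
Proof. by case: i. Qed.

(** Postcondition and step count travel together, so a correctness proof by the rules below also
    proves the time bound. Quantifying over [P] and [o] lets a fragment be verified independently of
    where it is placed. *)
Definition wp k c (Q : mem -> Prop) (m : mem) : Prop :=
  forall P o, placed P (code o c) o ->
  exists t m', [/\ t <= time k c,
    reaches P t (at_pc o m) (at_pc (o + clen c) m') & Q m'].

Variable k : nat.
Implicit Types (Q : mem -> Prop) (m : mem).

Lemma wp_mono c Q1 Q2 m : wp k c Q1 m -> (forall m, Q1 m -> Q2 m) -> wp k c Q2 m.
Proof.
by move=> w Q12 P o /w[t [m' [tt r q]]]; exists t, m'; split=> //; exact: Q12.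
Qed.

Lemma wp_skip Q m : Q m -> wp k Skip Q m.
Proof. by move=> q P o _; exists 0, m; rewrite addn0. Qed.

Lemma wp_prim i Q m : ~~ is_jump i -> Q (exec_prim i m) -> wp k (Prim i) Q m.
Proof.
move=> ji q P o /placed_cons[Pi _]; exists 1, (exec_prim i m); split=> //.
by rewrite /= addn1 -exec_primE//; exact: reaches1.
Qed.

Lemma wp_seq c1 c2 Q m : wp k c1 (wp k c2 Q) m -> wp k (Seq c1 c2) Q m.
Proof.
move=> w P o /placed_cat[/w[t1 [m1 [tt1 r1 w2]]]]; rewrite size_code => /w2.
move=> [t2 [m2 [tt2 r2 q]]]; exists (t1 + t2), m2; split=> //=.
  by rewrite leq_add.
by apply: reaches_trans r1 _; rewrite addnA.
Qed.

Lemma wp_if t c1 c2 Q m :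
  (holds t m -> wp k c1 Q m) -> (~~ holds t m -> wp k c2 Q m) ->
  wp k (Ifte t c1 c2) Q m.
Proof.
move=> w1 w2 P o /placed_cons[Pj /placed_cat[P2 /placed_cons[Pj2 P1]]].
have rj := reaches1 m Pj; rewrite exec_jump in rj.
case: ifPn rj => h rj.
  have e : o + clen c2 + 2 = (o.+1 + size (code o.+1 c2)).+1.
    by rewrite size_code; lia.
  rewrite {}e in rj P1 *.
  have [t1 [m' [tt r q]]] := w1 h _ _ P1.
  exists (1 + t1), m'; split=> //=; first by lia.
  apply: reaches_trans rj _; rewrite size_code in r *.
  by have <- : (o.+1 + clen c2).+1 + clen c1 = o + (clen c1 + clen c2 + 2) by lia.
have [t1 [m' [tt r q]]] := w2 h _ _ P2.
exists (1 + t1 + 1), m'; split=> //=; first by lia.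
apply: reaches_trans (reaches_trans rj r) _.
rewrite size_code in Pj2; have := reaches1 m' Pj2.
rewrite (exec_jump (NLe 0 0)) /= leqnn.
by have <- : o + clen c2 + 2 + clen c1 = o + (clen c1 + clen c2 + 2) by lia.
Qed.

(** The index of the invariant counts iterations; the obligation [j < k] yields both termination and
    the bound in [time]. *)
Lemma wp_while a b c Q (I : nat -> mem -> Prop) m :
  I 0 m ->
  (forall j m, I j m -> m.1 a < m.1 b -> j < k /\ wp k c (I j.+1) m) ->
  (forall j m, I j m -> m.1 b <= m.1 a -> Q m) ->
  wp k (While a b c) Q m.
Proof.
move=> I0 Istep Iend P o PW; have /placed_cons[Pj /placed_cat[P1 P2]] := PW.
have {P2}/placed_cons[Pj2 _] := P2; rewrite size_code in Pj2.
(* Here [d] bounds the iterations still allowed; when none is left, [Istep] excludes that the guard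
   holds. *)
suff loop d j m1 : k - j <= d -> I j m1 -> exists t m',
    [/\ t <= (k - j) * (time k c + 2) + 1,
      reaches P t (at_pc o m1) (at_pc (o + clen (While a b c)) m') & Q m'].
  by have := loop k 0 m; rewrite subn0; apply.
elim: d j m1 => [|d IH] j m1 jd Ij.
  have rj := reaches1 m1 Pj; rewrite (exec_jump (NLe b a)) /= in rj.
  case: leqP rj => ab rj; last by have [] := Istep _ _ Ij ab; lia.
  by exists 1, m1; split; rewrite ?addn1//= ?addnA//; exact: Iend Ij ab.
have rj := reaches1 m1 Pj; rewrite (exec_jump (NLe b a)) /= in rj.
case: leqP rj => ab rj.
  by exists 1, m1; split; rewrite ?leq_addl// /= ?addnA//; exact: Iend Ij ab.
have [jk w] := Istep _ _ Ij ab; have [t1 [m2 [tt1 r1 I1]]] := w _ _ P1.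
have [|t2 [m3 [tt2 r2 q]]] := IH j.+1 m2 _ I1; first lia.
exists (1 + t1 + 1 + t2), m3; split=> //.
  have -> : k - j = (k - j.+1).+1 by lia.
  by rewrite mulSn; lia.
apply: reaches_trans r2; apply: reaches_trans (reaches_trans rj r1) _.
by have := reaches1 m2 Pj2; rewrite (exec_jump (NLe 0 0)) /= leqnn.
Qed.

End Wp.

(** * A language with variables and arrays *)

Inductive nexp :=
| Var of nat
| Cst of nat
| Size
| NBin of nat_op & nexp & nexp
| Get of nat & nexp.

Inductive rexp :=
| RGet of nat & nexp
| RBin of real_op & rexp & rexp.

Inductive bexp :=
| BLe of nexp & nexp
| BRle of rexp & rexp
| BNot of bexp
| BAnd of bexp & bexp.

(* [For l x s] runs [s] for [x] from 0 to [n + l - 1], where [n] is the input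
   size.  The counter is hidden, so that assignments to [x] in [s] do not
   influence the number of iterations. *)
Inductive stm :=
| Nop
| Set_ of nat & nexp
| Put of nat & nexp & nexp
| RPut of nat & nexp & rexp
| Then of stm & stm
| If of bexp & stm & stm
| For of nat & nat & stm.

Definition upd T (f : nat -> T) (x : nat) (v : T) : nat -> T :=
  fun y => if y == x then v else f y.

Section Denotation.
Variables (R : realType) (n : nat).

Record store := Store {
  vars : nat -> nat;
  narr : nat -> nat -> nat;
  rarr : nat -> nat -> R
}.

Implicit Types (st : store).

Definition set_var st x v :=
  Store (upd (vars st) (x) v) (narr st) (rarr st).
Definition set_narr st a j v :=
  Store (vars st)
    (fun a' j' => if (a' == a) && (j' == j) then v else narr st a' j')
    (rarr st).
Definition set_rarr st a j v :=
  Store (vars st) (narr st)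
    (fun a' j' => if (a' == a) && (j' == j) then v else rarr st a' j').

Fixpoint neval st e : nat :=
  match e with
  | Var x => vars st x
  | Cst c => c
  | Size => n
  | NBin o e1 e2 => eval_nat_op o (neval st e1) (neval st e2)
  | Get a e => narr st a (neval st e)
  end.

Fixpoint reval st e : R :=
  match e with
  | RGet a e => rarr st a (neval st e)
  | RBin o e1 e2 => eval_real_op o (reval st e1) (reval st e2)
  end.

Fixpoint beval st b : bool :=
  match b with
  | BLe e1 e2 => neval st e1 <= neval st e2
  | BRle e1 e2 => (reval st e1 <= reval st e2)%R
  | BNot b => ~~ beval st b
  | BAnd b1 b2 => beval st b1 && beval st b2
  end.

Fixpoint run s st : store :=
  match s with
  | Nop => st
  | Set_ x e => set_var st x (neval st e)
  | Put a e1 e2 => set_narr st a (neval st e1) (neval st e2)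
  | RPut a e r => set_rarr st a (neval st e) (reval st r)
  | Then s1 s2 => run s2 (run s1 st)
  | If b s1 s2 => if beval st b then run s1 st else run s2 st
  | For l x s => foldl (fun st i => run s (set_var st x i)) st (iota 0 (n + l))
  end.

End Denotation.

(** Arrays are interleaved: entry [j] of array [a] lies at the base address plus [16 * j + a], so no
    array needs a size known in advance. Variables are the entries of the last natural-number array.
    Cells below [nregs] are registers; for [n > 0] the base [64 * n], obtained by six doublings,
    clears both them and the input. *)
Definition stride := 16.
Definition nregs := 64.

Fixpoint nfit (d : nat) (e : nexp) : bool :=
  match e with
  | Var _ | Cst _ | Size => d < nregs
  | NBin _ e1 e2 => nfit d e1 && nfit d.+1 e2
  | Get a e => [&& nfit d e, d.+1 < nregs & a.+1 < stride]
  end.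

Fixpoint rfit (d f : nat) (e : rexp) : bool :=
  match e with
  | RGet a e => [&& nfit d e, d.+1 < nregs, f < nregs & a < stride]
  | RBin _ e1 e2 => rfit d f e1 && rfit d f.+1 e2
  end.

Fixpoint bfit (d : nat) (b : bexp) : bool :=
  match b with
  | BLe e1 e2 => nfit d e1 && nfit d.+1 e2
  | BRle e1 e2 => [&& rfit d 0 e1, rfit d 1 e2 & d < nregs]
  | BNot b => bfit d b && (d.+1 < nregs)
  | BAnd b1 b2 => bfit d b1 && bfit d.+1 b2
  end.

(** A static check, settled by computation for the final program. The condition [l <= 1] caps every
    loop at [n + 1] iterations. *)
Fixpoint sfit (d : nat) (s : stm) : bool :=
  match s with
  | Nop => true
  | Set_ x e => nfit d e && (d.+1 < nregs)
  | Put a e1 e2 => [&& nfit d e1, d.+1 < nregs, nfit d.+1 e2 & a.+1 < stride]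
  | RPut a e r => [&& nfit d e, d.+1 < nregs, rfit d.+1 0 r & a < stride]
  | Then s1 s2 => sfit d s1 && sfit d s2
  | If b s1 s2 => [&& bfit d b, d.+1 < nregs, sfit d s1 & sfit d s2]
  | For l x s => [&& sfit d.+2 s, d.+2 < nregs & l <= 1]
  end.

(* Register 0 holds the base address, register 1 the input size, and the
   registers from [d] on are free. *)
Definition prims (l : seq instr) : cmd := foldr (fun i => Seq (Prim i)) Skip l.

Definition caddr (d a : nat) : cmd :=
  prims [:: NConst d.+1 stride; NOp NMul d d d.+1; NConst d.+1 a;
            NOp NAdd d d d.+1; NOp NAdd d 0 d].

Definition cvar (d x : nat) : cmd :=
  prims [:: NConst d (stride * x + stride.-1); NOp NAdd d 0 d].

Fixpoint cnexp (d : nat) (e : nexp) : cmd :=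
  match e with
  | Var x => Seq (cvar d x) (Prim (NLoad d d))
  | Cst c => Prim (NConst d c)
  | Size => prims [:: NConst d 0; NOp NAdd d 1 d]
  | NBin o e1 e2 =>
      Seq (cnexp d e1) (Seq (cnexp d.+1 e2) (Prim (NOp o d d d.+1)))
  | Get a e => Seq (cnexp d e) (Seq (caddr d a) (Prim (NLoad d d)))
  end.

Fixpoint crexp (d f : nat) (e : rexp) : cmd :=
  match e with
  | RGet a e => Seq (cnexp d e) (Seq (caddr d a) (Prim (RLoad f d)))
  | RBin o e1 e2 =>
      Seq (crexp d f e1) (Seq (crexp d f.+1 e2) (Prim (ROp o f f f.+1)))
  end.

Definition cbool (d : nat) (t : test) : cmd :=
  Ifte t (Prim (NConst d 1)) (Prim (NConst d 0)).

Fixpoint cbexp (d : nat) (b : bexp) : cmd :=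
  match b with
  | BLe e1 e2 => Seq (cnexp d e1) (Seq (cnexp d.+1 e2) (cbool d (NLe d d.+1)))
  | BRle e1 e2 => Seq (crexp d 0 e1) (Seq (crexp d 1 e2) (cbool d (RLe 0 1)))
  | BNot b => Seq (cbexp d b) (prims [:: NConst d.+1 1; NOp NSub d d.+1 d])
  | BAnd b1 b2 =>
      Seq (cbexp d b1) (Seq (cbexp d.+1 b2) (Prim (NOp NMul d d d.+1)))
  end.

Fixpoint cstm (d : nat) (s : stm) : cmd :=
  match s with
  | Nop => Skip
  | Set_ x e => Seq (cnexp d e) (Seq (cvar d.+1 x) (Prim (NStore d.+1 d)))
  | Put a e1 e2 =>
      Seq (cnexp d e1) (Seq (caddr d a) (Seq (cnexp d.+1 e2)
        (Prim (NStore d d.+1))))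
  | RPut a e r =>
      Seq (cnexp d e) (Seq (caddr d a) (Seq (crexp d.+1 0 r)
        (Prim (RStore d 0))))
  | Then s1 s2 => Seq (cstm d s1) (cstm d s2)
  | If b s1 s2 =>
      Seq (cbexp d b) (Seq (Prim (NConst d.+1 1))
        (Ifte (NLe d.+1 d) (cstm d s1) (cstm d s2)))
  | For l x s =>
      Seq (prims [:: NConst d 0; NConst d.+1 l; NOp NAdd d.+1 1 d.+1])
        (While d d.+1
          (Seq (Seq (cvar d.+2 x) (Prim (NStore d.+2 d)))
            (Seq (cstm d.+2 s)
              (prims [:: NConst d.+2 1; NOp NAdd d d d.+2]))))
  end.

Arguments prims : simpl never.
Arguments caddr : simpl never.
Arguments cvar : simpl never.
Arguments cbool : simpl never.
Arguments upd : simpl never.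

(** * Correctness of the compiler *)

Section Compile.
Variables (R : realType) (n k B : nat).
Hypotheses (nk : n < k) (KB : nregs <= B).
Implicit Types (m : mem R).

Definition addr (a j : nat) : nat := B + (stride * j + a).

Lemma addr_inj a j a' j' : a < stride -> a' < stride ->
  (addr a j == addr a' j') = (a == a') && (j == j').
Proof. by rewrite /addr /stride => *; lia. Qed.

Lemma addr_ge a j : nregs <= addr a j.
Proof. by rewrite /addr; lia. Qed.

(** Array numbers out of range read as zero: their addresses coincide with cells of other arrays, so
    a write would otherwise show up in several places. *)
Definition view m : store R :=
  Store (fun x => m.1 (addr stride.-1 x))
    (fun a j => if a.+1 < stride then m.1 (addr a j) else 0)
    (fun a j => if a < stride then m.2 (addr a j) else 0%R).

Definition based m := m.1 0 = B /\ m.1 1 = n.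

Definition same (d f : nat) m m' : Prop :=
  (forall x, x < d \/ nregs <= x -> m'.1 x = m.1 x) /\
  (forall x, x < f \/ nregs <= x -> m'.2 x = m.2 x).

Lemma same_trans d f m1 m2 m3 :
  same d f m1 m2 -> same d f m2 m3 -> same d f m1 m3.
Proof.
by move=> [h1 g1] [h2 g2]; split=> x xd; rewrite (h2,g2)// (h1,g1).
Qed.

Lemma same_weak d f d' f' m1 m2 : d <= d' -> f <= f' ->
  same d' f' m1 m2 -> same d f m1 m2.
Proof. by move=> dd ff [h g]; split=> x xd; rewrite (h,g)//; lia. Qed.

Lemma same_view d f m m' : same d f m m' -> view m' = view m.
Proof.
move=> [h g]; congr Store.
- by apply/funext => x; apply: h; right; exact: addr_ge.
- apply/funext => a; apply/funext => j; case: ifP => // _.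
  by apply: h; right; exact: addr_ge.
- apply/funext => a; apply/funext => j; case: ifP => // _.
  by apply: g; right; exact: addr_ge.
Qed.

Lemma same_based d f m m' : 1 < d -> same d f m m' -> based m -> based m'.
Proof. by move=> d1 [h _] []; rewrite /based !h//; lia. Qed.

Lemma same_upd d f m x v : d <= x < nregs ->
  same d f m ((upd (m.1) (x) v), m.2).
Proof. by move=> dx; split=> //= y yd; rewrite /upd; case: eqP => // ?; lia. Qed.

Lemma same_rupd d f m x v : f <= x < nregs ->
  same d f m (m.1, (upd (m.2) (x) v)).
Proof. by move=> dx; split=> //= y yd; rewrite /upd; case: eqP => // ?; lia. Qed.

Local Notation wp := (@wp R k).

Lemma wp_prims l Q m : all (fun i => ~~ is_jump i) l ->
  Q (foldl (fun m i => exec_prim i m) m l) -> wp (prims l) Q m.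
Proof.
rewrite /prims; elim: l m => [|i l IH] m /=; first by move=> _; exact: wp_skip.
by case/andP=> ji jl q; apply/wp_seq/wp_prim => //; exact: IH.
Qed.

Lemma caddrP d a m : 1 < d -> d.+1 < nregs -> based m ->
  wp (caddr d a) (fun m' => same d nregs m m' /\ m'.1 d = addr a (m.1 d)) m.
Proof.
move=> d1 dK [m0 _]; apply: wp_prims => //=.
have dd : (d == d.+1) = false by lia.
have d0 : (0 == d) = false by lia.
have d0' : (0 == d.+1) = false by lia.
rewrite /= !eqxx dd d0 ?d0' ?eqxx /= m0; split; last by rewrite /addr; lia.
split=> //= x xd; have [-> ->]// : (x == d) = false /\ (x == d.+1) = false.
by split; lia.
Qed.

Lemma cvarP d x m : 1 < d -> d < nregs -> based m ->
  wp (cvar d x) (fun m' => same d nregs m m' /\ m'.1 d = addr stride.-1 x) m.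
Proof.
move=> d1 dK [m0 _]; apply: wp_prims => //=.
have d0 : (0 == d) = false by lia.
rewrite /= !eqxx d0 m0; split; last by [].
by split=> //= y xd; have -> : (y == d) = false by lia.
Qed.

Lemma nfit_lt d e : nfit d e -> d < nregs.
Proof.
elim: e d => //= [? e1 IH e2 _ d /andP[]|a e IH d /andP[]]; auto.
Qed.

Lemma cnexpP d e m : 1 < d -> nfit d e -> based m ->
  wp (cnexp d e) (fun m' => same d nregs m m' /\ m'.1 d = neval n (view m) e) m.
Proof.
elim: e d m => [x|c||o e1 IH1 e2 IH2|a e IH] d m d1 /= fit bm.
- apply: wp_seq; apply: wp_mono (cvarP d1 fit bm) _ => m1 [s1 md].
  apply: wp_prim => //=; split.
    by apply: same_trans s1 _; apply: same_upd; lia.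
  by rewrite eqxx md (proj1 s1)//; right; exact: addr_ge.
- by apply: wp_prim => //=; rewrite eqxx; split=> //; apply: same_upd; lia.
- apply: wp_prims => //=; rewrite !eqxx; have -> : (1 == d) = false by lia.
  rewrite /= (proj2 bm) addn0; split=> //; split=> //= y yd.
  by case: eqP => // ?; lia.
- have /andP[f1 f2] := fit.
  apply: wp_seq; apply: wp_mono (IH1 d m d1 f1 bm) _ => m1 [s1 e1d].
  have bm1 := same_based d1 s1 bm.
  apply: wp_seq; apply: wp_mono (IH2 d.+1 m1 (leqW d1) f2 bm1) _ => m2 [s2 e2d].
  have dK := nfit_lt f1.
  apply: wp_prim => //=; rewrite eqxx; split.
    apply: same_trans s1 (same_trans (same_weak (leqnSn _) (leqnn _) s2) _).
    by apply: same_upd; lia.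
  by rewrite (proj1 s2 d) ?e1d ?e2d ?(same_view s1)//; lia.
- have /and3P[f1 f2 f3] := fit.
  apply: wp_seq; apply: wp_mono (IH d m d1 f1 bm) _ => m1 [s1 e1d].
  have bm1 := same_based d1 s1 bm.
  apply: wp_seq; apply: wp_mono (caddrP d1 f2 bm1) _ => m2 [s2 e2d].
  apply: wp_prim => //=; rewrite eqxx; split.
    by apply: same_trans s1 (same_trans s2 _); apply: same_upd; lia.
  rewrite f3 e2d e1d (proj1 s2) ?(proj1 s1)//; right; exact: addr_ge.
Qed.

Lemma crexpP d f e m : 1 < d -> rfit d f e -> based m ->
  wp (crexp d f e)
    (fun m' => same d f m m' /\ m'.2 f = reval n (view m) e) m.
Proof.
elim: e d f m => [a e|o e1 IH1 e2 IH2] d f m d1 /= fit bm.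
- have /and4P[f1 f2 f3 f4] := fit.
  apply: wp_seq; apply: wp_mono (cnexpP d1 f1 bm) _ => m1 [s1 e1d].
  have bm1 := same_based d1 s1 bm.
  apply: wp_seq; apply: wp_mono (caddrP d1 f2 bm1) _ => m2 [s2 e2d].
  apply: wp_prim => //=; rewrite eqxx; split.
    have s12 := same_weak (leqnn d) (ltnW f3) (same_trans s1 s2).
    by apply: same_trans s12 _; apply: same_rupd; lia.
  rewrite f4 e2d e1d (proj2 s2) ?(proj2 s1)//; right; exact: addr_ge.
- have /andP[f1 f2] := fit.
  apply: wp_seq; apply: wp_mono (IH1 d f m d1 f1 bm) _ => m1 [s1 e1d].
  have bm1 := same_based d1 s1 bm.
  apply: wp_seq; apply: wp_mono (IH2 d f.+1 m1 d1 f2 bm1) _ => m2 [s2 e2d].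
  have fK : f < nregs.
    by elim: (e1) (f) f1 => //= [? ? f' /and4P[]|? ? + ? _ f' /andP[]]; auto.
  apply: wp_prim => //=; rewrite eqxx; split.
    apply: same_trans s1 (same_trans (same_weak (leqnn _) (leqnSn _) s2) _).
    by apply: same_rupd; lia.
  by rewrite (proj2 s2 f) ?e1d ?e2d ?(same_view s1)//; lia.
Qed.

Lemma cboolP d t m : d < nregs ->
  wp (cbool d t) (fun m' => same d 0 m m' /\ m'.1 d = holds t m) m.
Proof.
move=> dK; apply: wp_if => [|/negPf] h; apply: wp_prim => //=;
  rewrite eqxx h; split=> //; apply: same_upd; lia.
Qed.

Lemma cbexpP d b m : 1 < d -> bfit d b -> based m ->
  wp (cbexp d b) (fun m' => same d 0 m m' /\ m'.1 d = beval n (view m) b) m.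
Proof.
elim: b d m => [e1 e2|e1 e2|b IH|b1 IH1 b2 IH2] d m d1 /= fit bm.
- have /andP[f1 f2] := fit.
  apply: wp_seq; apply: wp_mono (cnexpP d1 f1 bm) _ => m1 [s1 e1d].
  have bm1 := same_based d1 s1 bm.
  apply: wp_seq; apply: wp_mono (cnexpP (leqW d1) f2 bm1) _ => m2 [s2 e2d].
  apply: wp_mono (cboolP m2 (nfit_lt f1)) _ => m3 [s3 ->]; split.
    apply: same_trans s3; apply: same_trans (same_weak _ _ s1) _ => //.
    by apply: same_weak s2.
  by rewrite /= e2d (proj1 s2 d) ?e1d ?(same_view s1)//; lia.
- have /and3P[f1 f2 f3] := fit.
  apply: wp_seq; apply: wp_mono (crexpP d1 f1 bm) _ => m1 [s1 e1d].
  have bm1 := same_based d1 s1 bm.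
  apply: wp_seq; apply: wp_mono (crexpP d1 f2 bm1) _ => m2 [s2 e2d].
  apply: wp_mono (cboolP m2 f3) _ => m3 [s3 ->]; split.
    by apply: same_trans s3; apply: same_trans s1 _ => //; apply: same_weak s2.
  by rewrite /= e2d (proj2 s2 0) ?e1d ?(same_view s1)//; lia.
- have /andP[f1 f2] := fit.
  apply: wp_seq; apply: wp_mono (IH d m d1 f1 bm) _ => m1 [s1 e1d].
  apply: wp_prims => //=; rewrite !eqxx.
  have -> : (d == d.+1) = false by lia.
  split; last by rewrite /= e1d; case: beval.
  apply: same_trans s1 _; split=> //= x xd.
  by have [-> ->]// : (x == d) = false /\ (x == d.+1) = false by split; lia.
- have /andP[f1 f2] := fit.
  apply: wp_seq; apply: wp_mono (IH1 d m d1 f1 bm) _ => m1 [s1 e1d].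
  have bm1 := same_based d1 s1 bm.
  apply: wp_seq; apply: wp_mono (IH2 d.+1 m1 (leqW d1) f2 bm1) _ => m2 [s2 e2d].
  have dK : d < nregs.
    elim: (b1) (d) f1 => //= [? ? ? /andP[/nfit_lt]//|? ? ? /and3P[]//||];
      by move=> ? ? ? /andP[] || move=> ? ? ? ? ? /andP[]; auto.
  apply: wp_prim => //=; rewrite eqxx; split.
    apply: same_trans s1 (same_trans (same_weak (leqnSn _) (leqnn _) s2) _).
    by apply: same_upd; lia.
  rewrite (proj1 s2 d) ?e1d ?e2d ?(same_view s1) ?mulnb//; lia.
Qed.

Lemma view_var d f m m' x v : same d f m m' ->
  view ((upd (m'.1) (addr stride.-1 x) v), m'.2) = set_var (view m) x v.
Proof.
move=> s; rewrite -(same_view s) /view /set_var /upd /=; congr Store.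
  by apply/funext => y /=; rewrite addr_inj// eqxx.
apply/funext => a; apply/funext => j; case: ifP => // al.
rewrite addr_inj//; last by apply: ltnW.
by have -> : (a == stride.-1) = false by move: al; rewrite /stride; lia.
Qed.

Lemma view_narr m a j v : a.+1 < stride ->
  view ((upd (m.1) (addr a j) v), m.2) = set_narr (view m) a j v.
Proof.
move=> al; rewrite /view /set_narr /upd /=; congr Store.
  apply/funext => y /=; rewrite addr_inj//; last by apply: ltnW.
  by have -> : (stride.-1 == a) = false by move: al; rewrite /stride; lia.
apply/funext => a'; apply/funext => j'; case: ifP => // al'.
  by rewrite addr_inj//; apply: ltnW.
by case: eqP => //= aa; rewrite aa al in al'.
Qed.

Lemma view_rarr m a j v : a < stride ->
  view (m.1, (upd (m.2) (addr a j) v)) = set_rarr (view m) a j v.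
Proof.
move=> al; rewrite /view /set_rarr /upd /=; congr Store.
apply/funext => a'; apply/funext => j'; case: ifP => // al'.
  by rewrite addr_inj.
by case: eqP => //= aa; rewrite aa al in al'.
Qed.

(** Statements do change the memory above [nregs], so only the low registers are protected: base
    address, input size and the counters of enclosing loops. *)
Definition keeps d m m' := forall x, x < d -> m'.1 x = m.1 x.

Lemma cstmP d s m : 1 < d -> sfit d s -> based m ->
  wp (cstm d s) (fun m' => keeps d m m' /\ view m' = run n s (view m)) m.
Proof.
have keepA a j y : y < nregs -> (y == addr a j) = false.
  by move=> yK; have := addr_ge a j; lia.
elim: s d m => [|x e|a e1 e2|a e r|t1 IH1 t2 IH2|b t1 IH1 t2 IH2|l x s IH]
  d m d1 /= fit bm.
- exact: wp_skip.
- have /andP[f1 f2] := fit.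
  apply: wp_seq; apply: wp_mono (cnexpP d1 f1 bm) _ => m1 [s1 e1d].
  have bm1 := same_based d1 s1 bm.
  apply: wp_seq; apply: wp_mono (cvarP (leqW d1) f2 bm1) _ => m2 [s2 e2d].
  apply: wp_prim => //; rewrite /exec_prim /= e2d (proj1 s2 d) ?e1d//; last lia.
  split; last by rewrite -(same_view s1); exact: view_var s2.
  by move=> y yd; rewrite /= keepA ?(proj1 s2) ?(proj1 s1)//; lia.
- have /and4P[f1 f2 f3 f4] := fit.
  apply: wp_seq; apply: wp_mono (cnexpP d1 f1 bm) _ => m1 [s1 e1d].
  have bm1 := same_based d1 s1 bm.
  apply: wp_seq; apply: wp_mono (caddrP d1 f2 bm1) _ => m2 [s2 e2d].
  have bm2 := same_based d1 s2 bm1.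
  apply: wp_seq; apply: wp_mono (cnexpP (leqW d1) f3 bm2) _ => m3 [s3 e3d].
  apply: wp_prim => //; rewrite /exec_prim /= e3d (proj1 s3 d); last by left.
  rewrite e2d e1d; split.
    by move=> y yd; rewrite /= keepA ?(proj1 s3) ?(proj1 s2) ?(proj1 s1)//; lia.
  by rewrite view_narr// (same_view s3) (same_view s2) (same_view s1).
- have /and4P[f1 f2 f3 f4] := fit.
  apply: wp_seq; apply: wp_mono (cnexpP d1 f1 bm) _ => m1 [s1 e1d].
  have bm1 := same_based d1 s1 bm.
  apply: wp_seq; apply: wp_mono (caddrP d1 f2 bm1) _ => m2 [s2 e2d].
  have bm2 := same_based d1 s2 bm1.
  apply: wp_seq; apply: wp_mono (crexpP (leqW d1) f3 bm2) _ => m3 [s3 e3d].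
  apply: wp_prim => //; rewrite /exec_prim /= e3d (proj1 s3 d); last by left.
  rewrite e2d e1d; split.
    by move=> y yd; rewrite /= ?(proj1 s3) ?(proj1 s2) ?(proj1 s1)//; lia.
  by rewrite view_rarr// (same_view s3) (same_view s2) (same_view s1).
- have /andP[f1 f2] := fit.
  apply: wp_seq; apply: wp_mono (IH1 d m d1 f1 bm) _ => m1 [s1 v1].
  have bm1 : based m1 by move: bm; rewrite /based !s1//; lia.
  apply: wp_mono (IH2 d m1 d1 f2 bm1) _ => m2 [s2 v2]; split.
    by move=> x xd; rewrite s2// s1.
  by rewrite v2 v1.
- have /and4P[f1 f2 f3 f4] := fit.
  apply: wp_seq; apply: wp_mono (cbexpP d1 f1 bm) _ => m1 [s1 e1d].
  have bm1 := same_based d1 s1 bm.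
  apply: wp_seq; apply: wp_prim => //; rewrite /exec_prim /=.
  set m2 := (_, _).
  have s2 : same d.+1 0 m1 m2 by apply: same_upd; lia.
  have bm2 : based m2 by apply: same_based s2 bm1; lia.
  have k2 : keeps d m m2.
    by move=> y yd; rewrite (proj1 s2) ?(proj1 s1)//; lia.
  have m2d : m2.1 d = beval n (view m) b by rewrite (proj1 s2)//; left.
  have m2d1 : m2.1 d.+1 = 1 by rewrite /= eqxx.
  apply: wp_if; rewrite /holds m2d m2d1; case: beval => // _.
    apply: wp_mono (IH1 d m2 d1 f3 bm2) _ => m3 [s3 v3]; split.
      by move=> y yd; rewrite s3// k2.
    by rewrite v3 (same_view s2) (same_view s1).
  apply: wp_mono (IH2 d m2 d1 f4 bm2) _ => m3 [s3 v3]; split.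
    by move=> y yd; rewrite s3// k2.
  by rewrite v3 (same_view s2) (same_view s1).
- have /and3P[f1 f2 f3] := fit.
  apply: wp_seq; apply: wp_prims => //; set m1 := foldl _ m _.
  have s1 : same d 0 m m1.
    rewrite /m1; split=> //= y yd; rewrite /exec_prim/= .
    have yd1 : (y == d) = false by lia.
    have yd2 : (y == d.+1) = false by lia.
    by rewrite yd1 yd2.
  have m1d : m1.1 d = 0.
    by rewrite /m1 /= !eqxx; have -> : (d == d.+1) = false by lia.
  have m1d1 : m1.1 d.+1 = n + l.
    rewrite /m1 /= !eqxx; have -> : (1 == d.+1) = false by lia.
    have -> : (1 == d) = false by lia.
    by rewrite /= (proj2 bm).
  pose run_to j := foldl (fun st i => run n s (set_var st x i)) (view m) (iota 0 j).
  (* Registers [d] and [d.+1] hold the hidden counter and its bound. The body is compiled from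
     [d.+2] on and keeps both, even if it assigns to [x]. *)
  apply: (@wp_while _ _ _ _ _ _ (fun j m' => [/\ m'.1 d = j, m'.1 d.+1 = n + l,
    keeps d m m', j <= n + l & view m' = run_to j])).
  + split=> //; last by rewrite (same_view s1).
    by move=> y yd; rewrite (proj1 s1)//; left.
  + move=> j m2 [m2d m2d1 k2 jl v2]; rewrite m2d m2d1 => jnl; split; first by lia.
    have bm2 : based m2 by move: bm; rewrite /based !k2//; lia.
    have d2 : 1 < d.+2 by [].
    apply/wp_seq/wp_seq; apply: wp_mono (cvarP d2 f2 bm2) _ => m3 [s3 e3d].
    apply: wp_prim => //; rewrite /exec_prim /= e3d (proj1 s3 d); last lia.
    rewrite m2d; set m4 := (_, _).
    have v4 : view m4 = set_var (view m2) x j.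
      by rewrite -(view_var _ _ s3).
    have k4 : keeps d.+2 m2 m4.
      by move=> y yd; rewrite /m4/= keepA ?(proj1 s3)//; [left|lia].
    have bm4 : based m4 by move: bm2; rewrite /based !k4//; lia.
    apply: wp_seq; apply: wp_mono (IH d.+2 m4 d2 f1 bm4) _ => m5 [k5 v5].
    apply: wp_prims => //; set m6 := foldl _ m5 _.
    have m4d : m4.1 d = j by rewrite k4.
    have m4d1 : m4.1 d.+1 = n + l by rewrite k4.
    have s6 : same d 0 m5 m6.
      rewrite /m6; split=> //= y yd; rewrite /exec_prim/= .
      have yd1 : (y == d) = false by lia.
    have yd2 : (y == d.+2) = false by lia.
    by rewrite yd1 yd2.
    have dd : (d == d.+2) = false by lia.
    split=> //.
    4: by rewrite (same_view s6) v5 v4 v2 /run_to -[j.+1]addn1 iotaD foldl_cat.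
    * by rewrite /m6 /= !eqxx dd k5// m4d addn1.
    * rewrite /m6 /=; have -> : (d.+1 == d) = false by lia.
      by have -> : (d.+1 == d.+2) = false; [lia|rewrite k5].
    * move=> y yd; rewrite (proj1 s6); last by left.
      rewrite k5; last lia.
      rewrite k4; last lia.
      exact: k2.
  + move=> j m2 [-> -> k2 jl v2] nlj; split=> //.
    by rewrite v2; congr (foldl _ _ (iota 0 _)); lia.
Qed.

End Compile.

(** * The sweep *)

Section Sweep.
Variables (R : realType) (n : nat) (side : nat -> bool) (col : nat -> nat).
Variable d : nat -> nat -> R.

(* [(a, a', b, b')]: on the first line [a] is the last selected position before
   the sweep and [a'] the next one, and [b], [b'] are those on the second line;
   [n] stands for none. *)
Definition sweep := (nat * nat * nat * nat)%type.
Implicit Types (S : pred nat) (z : sweep) (c : bool).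

Definition prev_of c z := let: (a, _, b, _) := z in if c then b else a.
Definition next_of c z := let: (_, a, _, b) := z in if c then b else a.
Definition shift c z i x : sweep :=
  let: (a, a', b, b') := z in if c then (a, a', i, x) else (i, x, b, b').

Lemma sweepP z1 z2 : (forall c, prev_of c z1 = prev_of c z2) ->
  (forall c, next_of c z1 = next_of c z2) -> z1 = z2.
Proof.
case: z1 z2 => [[[a a'] b] b'] [[[e e'] f] f'] p q.
have := p false; have := p true; have := q false; have := q true.
by rewrite /= => -> -> -> ->.
Qed.

Lemma prev_shift c c' z i x :
  prev_of c (shift c' z i x) = if c' == c then i else prev_of c z.
Proof. by case: z => [[[? ?] ?] ?]; case: c c' => [] []. Qed.

Lemma next_shift c c' z i x :
  next_of c (shift c' z i x) = if c' == c then x else next_of c z.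
Proof. by case: z => [[[? ?] ?] ?]; case: c c' => [] []. Qed.

Definition bounded z := [/\ z.1.1.1 <= n, z.1.1.2 <= n, z.1.2 <= n & z.2 <= n].

Lemma boundedP z :
  bounded z <-> forall c, prev_of c z <= n /\ next_of c z <= n.
Proof.
case: z => [[[a a'] b] b']; rewrite /bounded /=; split.
  by move=> [? ? ? ?] [].
by move=> h; have [] := h true; have [] := h false.
Qed.

Lemma bounded_shift c z i x :
  bounded z -> i <= n -> x <= n -> bounded (shift c z i x).
Proof.
move=> /boundedP bz iN xN; apply/boundedP => c'; have [? ?] := bz c'.
by rewrite prev_shift next_shift; case: ifP.
Qed.

Definition neighbors z : seq nat := [:: z.1.1.1; z.1.1.2; z.1.2; z.2].

Lemma mem_neighbors z s :
  s \in neighbors z -> exists c, s = prev_of c z \/ s = next_of c z.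
Proof.
case: z => [[[a a'] b] b']; rewrite !inE /= => /or4P[] /eqP->.
- by exists false; left.
- by exists false; right.
- by exists true; left.
- by exists true; right.
Qed.

Lemma neighbors_mem z c :
  (prev_of c z \in neighbors z) && (next_of c z \in neighbors z).
Proof.
by case: z c => [[[a a'] b] b'] []; rewrite !inE /= !eqxx !orbT.
Qed.

(** The sentinel [n] is skipped both as a server and as a competitor. Any closest neighbor of the
    right color will do, in line with the tie rule of [consistent]. *)
Definition served p z : bool :=
  has (fun s => [&& s < n, col s == col p &
    all (fun r => (n <= r) || (d p s <= d p r)%R) (neighbors z)]) (neighbors z).

Fixpoint before S c i : nat :=
  if i is j.+1 then if S j && (side j == c) then j else before S c j else n.

(** Position [i] itself counts here but not in [before], so [i] is selected exactly when it is the
    pending entry on its line. An unsuccessful [find] returns [n - i], which gives the sentinel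
    [n]. *)
Definition after S c i : nat :=
  i + find (fun j => S j && (side j == c)) (iota i (n - i)).

Definition trail S i : sweep :=
  (before S false i, after S false i, before S true i, after S true i).

Lemma prev_trail S c i : prev_of c (trail S i) = before S c i.
Proof. by case: c. Qed.

Lemma next_trail S c i : next_of c (trail S i) = after S c i.
Proof. by case: c. Qed.

Lemma after_rec S c i : i < n ->
  after S c i = if S i && (side i == c) then i else after S c i.+1.
Proof.
move=> iN; rewrite /after -[n - i]prednK ?subn_gt0//= subnS.
by case: ifP => _; rewrite ?addn0 ?addnS ?addSn.
Qed.

Lemma after_end S c : after S c n = n.
Proof. by rewrite /after subnn addn0. Qed.

Lemma after_ge S c i : i <= after S c i.
Proof. exact: leq_addr. Qed.

Lemma after_le S c i : i <= n -> after S c i <= n.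
Proof.
move=> iN; rewrite /after; have := find_size (fun j => S j && (side j == c))
  (iota i (n - i)); rewrite size_iota; lia.
Qed.

Lemma before_lt S c i : before S c i < i \/ before S c i = n.
Proof. by elim: i => [|i IH] /=; [right|case: ifP => _; [left|lia]]. Qed.

Lemma before_sel S c i : before S c i < n ->
  S (before S c i) && (side (before S c i) == c).
Proof.
by elim: i => [|i IH] /=; rewrite ?ltnn//; case: ifP => // -> .
Qed.

Lemma after_sel S c i : after S c i < n ->
  S (after S c i) && (side (after S c i) == c).
Proof.
rewrite /after => an; have h : has (fun j => S j && (side j == c)) (iota i (n - i)).
  by rewrite has_find size_iota; lia.
have := nth_find 0 h; rewrite nth_iota//; lia.
Qed.

Lemma before_max S c i s : s < i -> S s -> side s = c -> i <= n ->
  s <= before S c i < i.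
Proof.
elim: i => // i IH si Ss sc iN /=; case: ifP => [_|nS]; first lia.
have {}si : s < i.
  by rewrite ltn_neqAle -ltnS si andbT; apply/eqP => e; rewrite -e Ss sc eqxx in nS.
by have := IH si Ss sc (ltnW iN); lia.
Qed.

Lemma after_min S c i s : i <= s < n -> S s -> side s = c -> after S c i <= s.
Proof.
move=> /andP[is_ sN] Ss sc; rewrite /after leqNgt; apply/negP => lt.
have lt' : s - i < find (fun j => S j && (side j == c)) (iota i (n - i)) by lia.
have := before_find 0 lt'; rewrite nth_iota; last lia.
by rewrite subnKC// Ss sc eqxx.
Qed.

Lemma bounded_trail S i : i <= n -> bounded (trail S i).
Proof.
move=> iN; apply/boundedP => c; rewrite prev_trail next_trail after_le//.
by have := before_lt S c i; split=> //; lia.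
Qed.

Lemma trail_sel S i : i < n -> S i ->
  next_of (side i) (trail S i) = i /\
  trail S i.+1 = shift (side i) (trail S i) i (after S (side i) i.+1).
Proof.
move=> iN Si; rewrite next_trail after_rec// Si eqxx; split=> //.
by apply: sweepP => c; rewrite ?prev_shift ?next_shift ?prev_trail ?next_trail /=
  ?(after_rec _ _ iN) Si /=; case: eqP => // ->.
Qed.

Lemma trail_unsel S i : i < n -> ~~ S i ->
  next_of (side i) (trail S i) != i /\ trail S i.+1 = trail S i.
Proof.
move=> iN /negPf nSi; rewrite next_trail after_rec// nSi /=; split.
  by have := after_ge S (side i) i.+1; lia.
by apply: sweepP => c; rewrite ?prev_trail ?next_trail /= ?(after_rec _ _ iN) nSi.
Qed.

(** The point [p] may lie on either line. Strictness excludes ties between a neighbor and a selected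
    point hidden behind it. *)
Hypothesis near : forall p r s, p < n -> r < n -> s < n -> side r = side s ->
  (s < r < p) || (p < r < s) -> (d p r < d p s)%R.

Lemma trail_mem S p s : p < n -> s \in neighbors (trail S p) -> s < n -> S s.
Proof.
move=> pn /mem_neighbors[c]; rewrite prev_trail next_trail.
by move=> [] -> lt; [have /andP[]:= before_sel lt|have /andP[]:= after_sel lt].
Qed.

Lemma trail_near S p s : p < n -> ~~ S p -> s < n -> S s ->
  s \in neighbors (trail S p) \/
  exists2 r, (r < n) && (r \in neighbors (trail S p)) & (d p r < d p s)%R.
Proof.
move=> pn nSp sn Ss; have /andP[] := neighbors_mem (trail S p) (side s).
rewrite prev_trail next_trail => mb ma.
case: (ltngtP s p) => [sp|ps|sp]; last 1 first.
- by rewrite -sp Ss in nSp.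
- have /andP[sb bp] := before_max sp Ss erefl (ltnW pn).
  have [->|ne] := eqVneq s (before S (side s) p); first by left.
  have bn : before S (side s) p < n by lia.
  right; exists (before S (side s) p); first by rewrite bn.
  have /andP[_ /eqP sd] := before_sel bn.
  by apply: near => //; rewrite ltn_neqAle ne sb bp.
- have asx : after S (side s) p <= s by apply: after_min => //; lia.
  have [->|ne] := eqVneq s (after S (side s) p); first by left.
  have an : after S (side s) p < n by lia.
  right; exists (after S (side s) p); first by rewrite an.
  have /andP[Sa /eqP sd] := after_sel an.
  have pa : p < after S (side s) p.
    rewrite ltn_neqAle after_ge andbT; apply/eqP => e.
    by rewrite -e in Sa; rewrite Sa in nSp.
  have sa : after S (side s) p < s by rewrite ltn_neqAle eq_sym ne.
  by apply: near => //; rewrite pa sa orbT.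
Qed.

Definition served_by S p : Prop :=
  exists s, [/\ s < n, S s, col s = col p &
    forall r, r < n -> S r -> (d p s <= d p r)%R].

(** By [trail_near], a selected point that is not a neighbor is strictly farther than some neighbor.
    So every closest selected point, tied or not, is a neighbor, and beating the neighbors means
    beating all. *)
Lemma servedP S p : p < n -> ~~ S p ->
  served_by S p <-> served p (trail S p).
Proof.
move=> pn nSp; split.
  move=> [s [sn Ss sc smin]]; apply/hasP; exists s.
    have [//|[r /andP[rn rm] lt]] := trail_near pn nSp sn Ss.
    by have := smin _ rn (trail_mem pn rm rn); rewrite leNgt lt.
  rewrite sn sc eqxx; apply/allP => r rm; case: leqP => //= rn.
  by apply: smin => //; exact: trail_mem rm rn.
move=> /hasP[s sm /and3P[sn /eqP sc /allP smin]].
exists s; split=> //; first exact: trail_mem sm sn.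
move=> r rn Sr; have [rm|[q /andP[qn qm] lt]] := trail_near pn nSp rn Sr.
  by have := smin _ rm; rewrite leqNgt rn.
by have := smin _ qm; rewrite leqNgt qn /= => /le_trans; apply; exact: ltW.
Qed.

(* [T i z] is the least number of positions that must be selected from [i] on
   when the sweep arrives at [i] in state [z], or [n.+1] if [z] is a dead end;
   [succ i z z'] says that [z'] is an optimal successor of [z]. *)
Definition optimal_at (T : nat -> sweep -> nat)
    (succ : nat -> sweep -> sweep -> Prop) i z : Prop :=
  if i == n then
    T i z = if (n <= next_of false z) && (n <= next_of true z) then 0 else n.+1
  else if next_of (side i) z == i then
    (forall x, x <= n -> T i z <= (T i.+1 (shift (side i) z i x)).+1) /\
    (T i z <= n -> exists x, [/\ x <= n, succ i z (shift (side i) z i x) &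
       T i z = (T i.+1 (shift (side i) z i x)).+1])
  else if served i z then succ i z z /\ T i z = T i.+1 z
  else T i z = n.+1.

Definition optimal T succ : Prop :=
  forall i z, i <= n -> bounded z -> optimal_at T succ i z.

Variables (T : nat -> sweep -> nat) (succ : nat -> sweep -> sweep -> Prop).
Hypothesis opt : optimal T succ.

Definition all_served S := forall p, p < n -> ~~ S p -> served_by S p.

(** The trail of [S] is one of the runs over which the table minimizes: at a selected position it
    guesses the true successor, and every other position is served. *)
Lemma optimal_le S i : all_served S -> i <= n ->
  T i (trail S i) <= count S (iota i (n - i)).
Proof.
move=> serv; move: {2}(n - i) (erefl (n - i)) => k.
elim: k i => [|k IH] i ik iN.
  have -> : i = n by lia.
  have := opt (leqnn n) (bounded_trail S (leqnn n)).
  by rewrite /optimal_at eqxx !next_trail !after_end leqnn => ->.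
have iltn : i < n by lia.
have {}IH := IH i.+1 ltac:(lia) iltn.
have -> : n - i = (n - i.+1).+1 by lia.
have bt := bounded_trail S iN; have := opt iN bt.
rewrite /optimal_at (ltn_eqF iltn).
rewrite [iota _ _]/= [count _ _]/=; have [Si|nSi] := boolP (S i).
  have [ni tS] := trail_sel iltn Si.
  rewrite ni eqxx => -[+ _] => /(_ _ (after_le S (side i) iltn)).
  by rewrite -tS; lia.
have [ni tS] := trail_unsel iltn nSi.
have /servedP := serv _ iltn nSi => /(_ iltn nSi) sv.
by rewrite (negPf ni) sv => -[_ ->]; rewrite add0n -tS.
Qed.

Lemma optimal_step i z : i < n -> bounded z -> T i z <= n -> exists z',
  [/\ succ i z z', bounded z', T i.+1 z' <= T i z &
    if next_of (side i) z == i then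
      T i z = (T i.+1 z').+1 /\ exists x, z' = shift (side i) z i x
    else [/\ T i z = T i.+1 z', z' = z & served i z]].
Proof.
move=> iN bz Tz; have := opt (ltnW iN) bz; rewrite /optimal_at (ltn_eqF iN).
case: eqP => [ni [_ /(_ Tz)[x [xn sc Te]]]|/eqP ni].
  exists (shift (side i) z i x); split=> //; rewrite ?Te//.
    by apply: bounded_shift => //; exact: ltnW.
  by split=> //; exists x.
by case: ifP => [sv [sc Te]|_ Te]; [exists z; rewrite Te|lia].
Qed.

Lemma optimal_path z : bounded z -> T 0 z <= n -> exists zs : nat -> sweep,
  [/\ zs 0 = z, forall i, i <= n -> bounded (zs i) /\ T i (zs i) <= n &
    forall i, i < n -> succ i (zs i) (zs i.+1) /\
      if next_of (side i) (zs i) == i then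
        T i (zs i) = (T i.+1 (zs i.+1)).+1 /\
          exists x, zs i.+1 = shift (side i) (zs i) i x
      else [/\ T i (zs i) = T i.+1 (zs i.+1), zs i.+1 = zs i
             & served i (zs i)]].
Proof.
(* Choice turns the existence of optimal successors into a function, and the path is its
   iteration. *)
move=> bz Tz; have [f fP] : {f : nat -> sweep -> sweep & forall i z, i < n ->
    bounded z -> T i z <= n -> [/\ succ i z (f i z), bounded (f i z),
      T i.+1 (f i z) <= T i z & if next_of (side i) z == i then
      T i z = (T i.+1 (f i z)).+1 /\ exists x, f i z = shift (side i) z i x
    else [/\ T i z = T i.+1 (f i z), f i z = z & served i z]]}.
  have ex i z1 : exists z', i < n -> bounded z1 -> T i z1 <= n ->
      [/\ succ i z1 z', bounded z', T i.+1 z' <= T i z1 &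
      if next_of (side i) z1 == i then
        T i z1 = (T i.+1 z').+1 /\ exists x, z' = shift (side i) z1 i x
      else [/\ T i z1 = T i.+1 z', z' = z1 & served i z1]].
    have [[iN [b1 T1]]|no] := pselect (i < n /\ bounded z1 /\ T i z1 <= n).
      by have [z' ?] := optimal_step iN b1 T1; exists z'.
    by exists z1 => iN b1 T1; case: no.
  by exists (fun i z => sval (cid (ex i z))) => i z1; exact: svalP (cid (ex i z1)).
pose zs := fix zs i := if i is j.+1 then f j (zs j) else z.
have zsP i : i <= n -> bounded (zs i) /\ T i (zs i) <= n.
  elim: i => [|i IH] // iN; have [b1 T1] := IH (ltnW iN).
  by have [_ ? le _] := fP _ _ iN b1 T1; split=> //=; exact: leq_trans le T1.
exists zs; split=> // i iN; have [b1 T1] := zsP i (ltnW iN).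
by have [? _ _ ?] := fP _ _ iN b1 T1.
Qed.

Section Path.
Variable zs : nat -> sweep.
Hypothesis bz : forall i, i <= n -> bounded (zs i).
Hypothesis Tz : forall i, i <= n -> T i (zs i) <= n.
Hypothesis z0 : forall c, prev_of c (zs 0) = n.
Hypothesis zS : forall i, i < n -> if next_of (side i) (zs i) == i then
  T i (zs i) = (T i.+1 (zs i.+1)).+1 /\
    exists x, zs i.+1 = shift (side i) (zs i) i x
  else [/\ T i (zs i) = T i.+1 (zs i.+1), zs i.+1 = zs i & served i (zs i)].

(** Selections are recognized by a drop of the table value along the path, which the machine can
    test without decoding a state from its cell number. *)
Definition chosen : pred nat := fun i => T i.+1 (zs i.+1) < T i (zs i).

Lemma chosenE i : i < n -> chosen i = (next_of (side i) (zs i) == i).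
Proof.
move=> iN; rewrite /chosen; have := zS iN.
by case: ifP => _ [-> _]; rewrite ?ltnn ?ltnSn.
Qed.

(** The [prev] components agree by forward induction from the start. The [next] components are
    guesses, so they are compared backwards from the end, where finite cost forces both to be
    [n]. *)
Lemma path_trail i : i <= n -> zs i = trail chosen i.
Proof.
move=> iN; apply: sweepP => c; rewrite ?prev_trail ?next_trail.
  elim: i iN => [|i IH] iN /=; first by rewrite z0.
  have := zS iN; rewrite chosenE//; case: ifP => _ /=.
    by move=> [_ [x ->]]; rewrite prev_shift IH// ltnW.
  by move=> [_ -> _]; rewrite IH// ltnW.
move: {2}(n - i) (erefl (n - i)) => k.
elim: k i iN => [|k IH] i iN ik.
  have -> : i = n by lia.
  have := Tz (leqnn n); have := opt (leqnn n) (bz (leqnn n)).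
  rewrite /optimal_at eqxx => ->; rewrite after_end.
  case: ifP; last by rewrite ltnn.
  move=> /andP[n0 n1] _; have /boundedP/(_ c)[_] := bz (leqnn n).
  by case: c => h; apply/eqP; rewrite eqn_leq h ?n0 ?n1.
have iltn : i < n by lia.
have {}IH := IH i.+1 iltn ltac:(lia).
rewrite after_rec// chosenE//; have := zS iltn; case: eqP => ni /=.
  move=> [_ [x e]]; move: IH; rewrite e next_shift; case: eqP => // <- _.
  by rewrite ni.
by move=> [_ <- _].
Qed.

Lemma path_served : all_served chosen.
Proof.
move=> p pn nSp; apply/servedP => //; rewrite -path_trail; last exact: ltnW.
by move: nSp; rewrite chosenE//; have := zS pn; case: ifP => // _ [].
Qed.

Lemma path_count i : i <= n -> T i (zs i) = count chosen (iota i (n - i)).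
Proof.
move: {2}(n - i) (erefl (n - i)) => k.
elim: k i => [|k IH] i ik iN.
  have -> : i = n by lia.
  have := Tz (leqnn n); have := opt (leqnn n) (bz (leqnn n)).
  rewrite /optimal_at eqxx => ->; rewrite subnn /=.
  by case: ifP => //; rewrite ltnn.
have iltn : i < n by lia.
have {}IH := IH i.+1 ltac:(lia) iltn.
have -> : n - i = (n - i.+1).+1 by lia.
rewrite [iota _ _]/= [count _ _]/= -IH chosenE//.
by have := zS iltn; case: ifP => _ [-> _].
Qed.

End Path.

End Sweep.

(** * The algorithm *)

(** Syntactic bounds on what a statement may write; that something stays unchanged is then settled
    by computation. *)
Fixpoint var_writes (s : stm) : seq nat :=
  match s with
  | Set_ x _ => [:: x]
  | Then s1 s2 | If _ s1 s2 => var_writes s1 ++ var_writes s2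
  | For _ x s => x :: var_writes s
  | _ => [::]
  end.

Fixpoint narr_writes (s : stm) : seq nat :=
  match s with
  | Put a _ _ => [:: a]
  | Then s1 s2 | If _ s1 s2 => narr_writes s1 ++ narr_writes s2
  | For _ _ s => narr_writes s
  | _ => [::]
  end.

Fixpoint rarr_writes (s : stm) : seq nat :=
  match s with
  | RPut a _ _ => [:: a]
  | Then s1 s2 | If _ s1 s2 => rarr_writes s1 ++ rarr_writes s2
  | For _ _ s => rarr_writes s
  | _ => [::]
  end.

Definition bLt e1 e2 := BNot (BLe e2 e1).
Definition bOr b1 b2 := BNot (BAnd (BNot b1) (BNot b2)).
Definition bEq e1 e2 := BAnd (BLe e1 e2) (BLe e2 e1).
Definition bAll (bs : seq bexp) := foldr BAnd (BLe (Cst 0) (Cst 0)) bs.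
Definition bAny (bs : seq bexp) := foldr bOr (BLe (Cst 1) (Cst 0)) bs.
Definition nAdd := NBin NAdd.
Definition nMul := NBin NMul.
Definition nSucc e := nAdd e (Cst 1).
Definition rSq r := RBin RMul r r.

Arguments beval : simpl never.
Arguments bAll : simpl never.
Arguments bAny : simpl never.
Arguments bOr : simpl never.
Arguments bEq : simpl never.
Arguments bLt : simpl never.

(** * Loop rule and frame properties *)

Section Frames.
Variables (R : realType) (n : nat).
Implicit Types (st : store R) (s : stm).

Lemma run_for (I : nat -> store R -> Prop) l x s st :
  I 0 st ->
  (forall j st, j < n + l -> I j st -> I j.+1 (run n s (set_var st x j))) ->
  I (n + l) (run n (For l x s) st).
Proof.
move=> I0 IS /=; elim: (n + l) IS => // N IH IS.
rewrite -addn1 iotaD foldl_cat /= add0n addn1; apply: (IS) => //.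
by apply: IH => j st1 jN; apply: IS; exact: ltnW.
Qed.

Lemma run_nop st : run n Nop st = st. Proof. by []. Qed.

Lemma run_set st x e : run n (Set_ x e) st = set_var st x (neval n st e).
Proof. by []. Qed.

Lemma run_put st a e1 e2 :
  run n (Put a e1 e2) st = set_narr st a (neval n st e1) (neval n st e2).
Proof. by []. Qed.

Lemma run_rput st a e r :
  run n (RPut a e r) st = set_rarr st a (neval n st e) (reval n st r).
Proof. by []. Qed.

Lemma run_then st s1 s2 : run n (Then s1 s2) st = run n s2 (run n s1 st).
Proof. by []. Qed.

Lemma run_if st b s1 s2 :
  run n (If b s1 s2) st = if beval n st b then run n s1 st else run n s2 st.
Proof. by []. Qed.

Definition runE := (run_nop, run_set, run_put, run_rput, run_then, run_if).

Lemma run_vars s st x : x \notin var_writes s -> vars (run n s st) x = vars st x.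
Proof.
elim: s st => //= [y e|s1 IH1 s2 IH2|b s1 IH1 s2 IH2|l y s IH] st.
- by rewrite inE /upd => /negPf->.
- by rewrite mem_cat negb_or => /andP[? ?]; rewrite IH2// IH1.
- by rewrite mem_cat negb_or => /andP[? ?]; case: ifP => _; rewrite ?IH2// IH1.
- rewrite inE negb_or => /andP[/negPf xy xs]; elim: (iota _ _) st => //= i r IHr st.
  by rewrite IHr IH//= /upd xy.
Qed.

Lemma run_narr s st a : a \notin narr_writes s ->
  narr (run n s st) a = narr st a.
Proof.
elim: s st => //= [b e1 e2|s1 IH1 s2 IH2|b s1 IH1 s2 IH2|l y s IH] st.
- by rewrite inE => /negPf ab; apply/funext => j; rewrite ab.
- by rewrite mem_cat negb_or => /andP[? ?]; rewrite IH2// IH1.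
- by rewrite mem_cat negb_or => /andP[? ?]; case: ifP => _; rewrite ?IH2// IH1.
- by move=> xs; elim: (iota _ _) st => //= i r IHr st; rewrite IHr IH.
Qed.

Lemma run_rarr s st a : a \notin rarr_writes s ->
  rarr (run n s st) a = rarr st a.
Proof.
elim: s st => //= [b e1 e2|s1 IH1 s2 IH2|b s1 IH1 s2 IH2|l y s IH] st.
- by rewrite inE => /negPf ab; apply/funext => j; rewrite ab.
- by rewrite mem_cat negb_or => /andP[? ?]; rewrite IH2// IH1.
- by rewrite mem_cat negb_or => /andP[? ?]; case: ifP => _; rewrite ?IH2// IH1.
- by move=> xs; elim: (iota _ _) st => //= i r IHr st; rewrite IHr IH.
Qed.

Lemma beval_le st e1 e2 :
  beval n st (BLe e1 e2) = (neval n st e1 <= neval n st e2).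
Proof. by []. Qed.

Lemma beval_rle st e1 e2 :
  beval n st (BRle e1 e2) = (reval n st e1 <= reval n st e2)%R.
Proof. by []. Qed.

Lemma beval_not st b : beval n st (BNot b) = ~~ beval n st b.
Proof. by []. Qed.

Lemma beval_and st b1 b2 :
  beval n st (BAnd b1 b2) = beval n st b1 && beval n st b2.
Proof. by []. Qed.

Lemma beval_lt st e1 e2 :
  beval n st (bLt e1 e2) = (neval n st e1 < neval n st e2).
Proof. by rewrite /beval /= -ltnNge. Qed.

Lemma beval_eq st e1 e2 :
  beval n st (bEq e1 e2) = (neval n st e1 == neval n st e2).
Proof. by rewrite /beval /= -eqn_leq. Qed.

Lemma beval_or st b1 b2 :
  beval n st (bOr b1 b2) = beval n st b1 || beval n st b2.
Proof. by rewrite [LHS]/= /bOr !beval_not beval_and !beval_not negb_and !negbK. Qed.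

Lemma beval_all st bs : beval n st (bAll bs) = all (beval n st) bs.
Proof. by rewrite /bAll; elim: bs => //= b bs <-. Qed.

Lemma beval_any st bs : beval n st (bAny bs) = has (beval n st) bs.
Proof. by rewrite /bAny; elim: bs => //= b bs <-; rewrite -beval_or. Qed.

End Frames.

Notation vI := 0 (only parsing).
Notation vJ := 1 (only parsing).
Notation vA := 2 (only parsing).
Notation vA' := 3 (only parsing).
Notation vB := 4 (only parsing).
Notation vB' := 5 (only parsing).
Notation vX := 6 (only parsing).
Notation vCell := 7 (only parsing).
Notation vBest := 8 (only parsing).
Notation vSucc := 9 (only parsing).
Notation vTry := 10 (only parsing).

Notation aCol := 0 (only parsing).
(** The same array as [aCol]: the colors have been copied in sorted order before any output is
    written. *)
Notation aOut := 0 (only parsing).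
Notation aPerm := 1 (only parsing).
Notation aSortedCol := 2 (only parsing).
Notation aSide := 3 (only parsing).
Notation aTable := 4 (only parsing).
Notation aSucc := 5 (only parsing).

Notation aX := 0 (only parsing).
Notation aY := 1 (only parsing).
Notation aNormal := 2 (only parsing).
Notation aT := 3 (only parsing).
Notation aH := 4 (only parsing).
Notation aSortedT := 5 (only parsing).
Notation aSortedH := 6 (only parsing).

(** Cross and dot product with the normal vector: the coordinates along and across the lines, both
    multiplied by the length of that vector. *)
Definition project_points : stm :=
  For 0 vI (Then
    (RPut aT (Var vI)
      (RBin RSub (RBin RMul (RGet aNormal (Cst 0)) (RGet aY (Var vI)))
                 (RBin RMul (RGet aNormal (Cst 1)) (RGet aX (Var vI)))))
    (RPut aH (Var vI)
      (RBin RAdd (RBin RMul (RGet aNormal (Cst 0)) (RGet aX (Var vI)))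
                 (RBin RMul (RGet aNormal (Cst 1)) (RGet aY (Var vI)))))).

(** Sorting by counting predecessors is quadratic, well within the bound. Ties are broken by index,
    so ranks are distinct even for points that face each other on the two lines. *)
Definition rank_point : stm :=
  Then (Set_ vX (Cst 0))
    (For 0 vJ (If (bOr (BNot (BRle (RGet aT (Var vI)) (RGet aT (Var vJ))))
                       (BAnd (BRle (RGet aT (Var vJ)) (RGet aT (Var vI)))
                             (bLt (Var vJ) (Var vI))))
                (Set_ vX (nSucc (Var vX))) Nop)).

Definition sort_points : stm :=
  For 0 vI (Then rank_point
    (Then (Put aPerm (Var vX) (Var vI))
    (Then (Put aSortedCol (Var vX) (Get aCol (Var vI)))
    (Then (RPut aSortedT (Var vX) (RGet aT (Var vI)))
          (RPut aSortedH (Var vX) (RGet aH (Var vI))))))).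

(** Side 0 is the line of the first point in sorted order, whichever of the two that is. *)
Definition classify_points : stm :=
  For 0 vI (Then (Put aOut (Var vI) (Cst 0))
    (If (BAnd (BRle (RGet aSortedH (Var vI)) (RGet aSortedH (Cst 0)))
              (BRle (RGet aSortedH (Cst 0)) (RGet aSortedH (Var vI))))
      (Put aSide (Var vI) (Cst 0)) (Put aSide (Var vI) (Cst 1)))).

(* The entries of a sweep state are at most [n], so they are the digits of a
   number in base [n + 1]. *)
Definition cell_exp (i a a' b b' : nexp) : nexp :=
  foldl (fun e x => nAdd (nMul e (nSucc Size)) x) i [:: a; a'; b; b'].

Definition sqdist_exp (p q : nexp) : rexp :=
  RBin RAdd (rSq (RBin RSub (RGet aSortedT p) (RGet aSortedT q)))
            (rSq (RBin RSub (RGet aSortedH p) (RGet aSortedH q))).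

Definition served_exp : bexp :=
  let nbs := [:: Var vA; Var vA'; Var vB; Var vB'] in
  bAny [seq bAll [:: bLt s Size;
                     bEq (Get aSortedCol s) (Get aSortedCol (Var vI));
                     bAll [seq bOr (BLe Size r)
                       (BRle (sqdist_exp (Var vI) s) (sqdist_exp (Var vI) r))
                     | r <- nbs]]
       | s <- nbs].

(** The pending entry decides: if it is the current position, selection is forced; otherwise the
    position must be served. [n + 1] stands for infinity, and the strict comparison caps the minimum
    at it. The successor stored at a dead end is arbitrary and never followed. *)
Definition branch (next : nat) (target : nexp) : stm :=
  If (bEq (Var next) (Var vI))
    (Then (Set_ vBest (nSucc Size))
    (Then (Set_ vSucc (Cst 0))
    (Then (For 1 vX (Then (Set_ vTry target)
       (If (bLt (nSucc (Get aTable (Var vTry))) (Var vBest))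
         (Then (Set_ vBest (nSucc (Get aTable (Var vTry))))
               (Set_ vSucc (Var vTry))) Nop)))
    (Then (Put aTable (Var vCell) (Var vBest))
          (Put aSucc (Var vCell) (Var vSucc))))))
    (If served_exp
      (Then (Set_ vTry
        (cell_exp (nSucc (Var vI)) (Var vA) (Var vA') (Var vB) (Var vB')))
      (Then (Put aTable (Var vCell) (Get aTable (Var vTry)))
            (Put aSucc (Var vCell) (Var vTry))))
      (Put aTable (Var vCell) (nSucc Size))).

Definition fill_cell : stm :=
  Then (Set_ vCell (cell_exp (Var vI) (Var vA) (Var vA') (Var vB) (Var vB')))
  (If (BLe Size (Var vI))
    (If (BAnd (BLe Size (Var vA')) (BLe Size (Var vB')))
      (Put aTable (Var vCell) (Cst 0)) (Put aTable (Var vCell) (nSucc Size)))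
    (If (BLe (Get aSide (Var vI)) (Cst 0))
      (branch vA'
        (cell_exp (nSucc (Var vI)) (Var vI) (Var vX) (Var vB) (Var vB')))
      (branch vB'
        (cell_exp (nSucc (Var vI)) (Var vA) (Var vA') (Var vI) (Var vX))))).

(** Loops only count upwards, so positions descend through [n - vJ]. The five loops here and the one
    over [vX] in [branch] make the nesting depth six. *)
Definition fill_table : stm :=
  For 1 vJ (Then (Set_ vI (NBin NSub Size (Var vJ)))
    (For 1 vA (For 1 vA' (For 1 vB (For 1 vB' fill_cell))))).

Definition choose_start : stm :=
  Then (Set_ vBest (nSucc Size))
  (For 1 vA' (For 1 vB'
    (Then (Set_ vTry (cell_exp (Cst 0) Size (Var vA') Size (Var vB')))
    (If (bLt (Get aTable (Var vTry)) (Var vBest))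
      (Then (Set_ vBest (Get aTable (Var vTry))) (Set_ vCell (Var vTry))) Nop)))).

Definition read_off : stm :=
  For 0 vI (Then (Set_ vTry (Get aSucc (Var vCell)))
    (Then (If (BLe (Get aTable (Var vCell)) (Get aTable (Var vTry)))
             Nop (Put aOut (Get aPerm (Var vI)) (Cst 1)))
          (Set_ vCell (Var vTry)))).

Definition solve : stm :=
  foldr Then Nop [:: project_points; sort_points; classify_points; fill_table;
    choose_start; read_off].

Arguments cell_exp : simpl never.
Arguments sqdist_exp : simpl never.
Arguments served_exp : simpl never.
Arguments branch : simpl never.
Arguments fill_cell : simpl never.
Arguments rank_point : simpl never.

Arguments run : simpl never.

Lemma solve_fits : sfit 2 solve. Proof. by []. Qed.

Definition cell (n i : nat) (z : sweep) : nat :=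
  foldl (fun e x => e * n.+1 + x) i (neighbors z).

Lemma digit_inj m a b a' b' : b <= m -> b' <= m ->
  a * m.+1 + b = a' * m.+1 + b' -> a = a' /\ b = b'.
Proof.
move=> bm bm' e; have := congr1 (divn^~ m.+1) e; have := congr1 (modn^~ m.+1) e.
by rewrite !modnMDl !divnMDl// !modn_small// !divn_small// !addn0.
Qed.

Lemma cell_inj n i z i' z' : bounded n z -> bounded n z' ->
  cell n i z = cell n i' z' -> i = i' /\ z = z'.
Proof.
case: z z' => [[[a a'] b] b'] [[[e e'] f] f'] [/= ? ? ? ?] [/= ? ? ? ?].
rewrite /cell /=.
move=> /digit_inj[]// /digit_inj[]// /digit_inj[]// /digit_inj[]//.
by move=> -> -> -> -> ->.
Qed.

(** * Correctness of the table *)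

Section Fill.
Variables (R : realType) (n : nat) (st0 : store R).
Implicit Types (st : store R) (z : sweep).

Definition store_side p : bool := narr st0 aSide p != 0.
Definition store_col p : nat := narr st0 aSortedCol p.
Definition store_sqdist p q : R := reval n st0 (sqdist_exp (Cst p) (Cst q)).

Local Notation served_at := (served n store_col store_sqdist).

Definition static st : Prop :=
  [/\ narr st aSide = narr st0 aSide,
      narr st aSortedCol = narr st0 aSortedCol & rarr st = rarr st0].

Definition in_state st i z : Prop :=
  vars st vI = i /\
  z = (vars st vA, vars st vA', vars st vB, vars st vB').

Lemma neval_cell st i a a' b b' :
  neval n st (cell_exp i a a' b b') =
  cell n (neval n st i) (neval n st a, neval n st a', neval n st b, neval n st b').
Proof. by rewrite /cell /cell_exp /= !addn1. Qed.

Lemma beval_served st i z : static st -> in_state st i z ->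
  beval n st served_exp = served_at i z.
Proof.
move=> [_ ec er] [ei ez]; rewrite beval_any /served.
set l := [:: Var vA; Var vA'; Var vB; Var vB'].
have -> : neighbors z = [seq neval n st x | x <- l] by rewrite ez.
rewrite !has_map; apply: eq_has => s.
set p := RHS; have {p}-> : p = [&& neval n st s < n,
  store_col (neval n st s) == store_col i &
  all (fun r => (n <= r) || (store_sqdist i (neval n st s) <= store_sqdist i r)%R)
    [seq neval n st x | x <- l]] by [].
rewrite [LHS]beval_all [LHS]/= beval_lt beval_eq andbT; congr [&& _, _ & _].
  by rewrite /= /store_col ec ei.
rewrite beval_all -[X in all _ X]/[seq bOr (BLe Size r)
  (BRle (sqdist_exp (Var vI) s) (sqdist_exp (Var vI) r)) | r <- l] !all_map.
apply: eq_all => r /=.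
by rewrite beval_or beval_le beval_rle /store_sqdist /sqdist_exp /= er ei.
Qed.

Definition table st i z : nat := narr st aTable (cell n i z).
Arguments table : simpl never.
Definition succ_cell st i z z' : Prop :=
  narr st aSucc (cell n i z) = cell n i.+1 z'.

Local Notation optimal_cell st :=
  (optimal_at n store_side store_col store_sqdist (table st) (succ_cell st)).

Definition fills st st' i z : Prop :=
  [/\ (forall c, c != cell n i z -> narr st' aTable c = narr st aTable c),
      (forall c, c != cell n i z -> narr st' aSucc c = narr st aSucc c) &
      optimal_cell st' i z].

Lemma branchP c next target st i z :
  static st -> in_state st i z -> i < n -> bounded n z ->
  vars st vCell = cell n i z -> store_side i = c ->
  vars st next = next_of c z ->
  (forall st' x, (forall y, y \in [:: vI; vA; vA'; vB; vB'] ->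
      vars st' y = vars st y) ->
    neval n (set_var st' vX x) target = cell n i.+1 (shift c z i x)) ->
  fills st (run n (branch next target) st) i z.
Proof.
move=> sst zst iN bz ecell side_i enext etarget.
have [ei ez] := zst.
(* Transitions read row [i.+1] only, which a write to the current cell does not touch. *)
have other z' : bounded n z' -> (cell n i.+1 z' == cell n i z) = false.
  by move=> bz'; apply/eqP => /cell_inj[]//; lia.
rewrite /branch !runE !neval_cell beval_eq /= enext ei.
rewrite /fills /optimal_at (ltn_eqF iN) side_i.
case: eqP => [ni|/eqP ni]; last first.
  rewrite (beval_served sst zst); case: ifP => [sv|nsv] /=.
    rewrite /upd /= addn1 -ez ecell.
    rewrite /table.
    by split=> [e /negPf->|e /negPf->|]; rewrite /succ_cell /= ?eqxx ?other.
  rewrite /table /= ecell addn1.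
  by split=> [e /negPf->|e|]; rewrite ?eqxx.
set body := run n _ _.
(* [vBest] is the minimum over the guesses below [j], capped at [n.+1]; below the cap, [vSucc]
   records a guess that attains it. *)
pose I j st' := [/\
  (forall y, y \notin [:: vX; vTry; vBest; vSucc] -> vars st' y = vars st y),
  narr st' = narr st,
  vars st' vBest <= n.+1,
  (forall x, x < j -> vars st' vBest <= (table st i.+1 (shift c z i x)).+1) &
  (vars st' vBest <= n -> exists x, [/\ x < j,
     vars st' vSucc = cell n i.+1 (shift c z i x) &
     vars st' vBest = (table st i.+1 (shift c z i x)).+1])].
have : I (n + 1) body.
  apply: run_for.
    rewrite addn1; split=> //= [y|]; last by rewrite ltnn.
    by rewrite !inE !negb_or /upd => /and4P[_ _ /negPf-> /negPf->].
  move=> j st' jN [Iv In Ib Imin Iatt].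
  have Iv' y : y \in [:: vI; vA; vA'; vB; vB'] -> vars st' y = vars st y.
    by rewrite !inE => /orP[|/or4P[]] /eqP->; apply: Iv.
  rewrite run_then; have -> : run n (Set_ vTry target) (set_var st' vX j) =
      set_var (set_var st' vX j) vTry (cell n i.+1 (shift c z i j)).
    by rewrite !runE etarget.
  rewrite !runE beval_lt /= /upd /= In addn1 -/(table st i.+1 (shift c z i j)).
  case: ltnP => lt; split; rewrite /= /upd /= ?In //.
  - move=> y yn; move: (yn); rewrite !inE !negb_or.
    move=> /and4P[/negPf-> /negPf-> /negPf-> /negPf->].
    exact: Iv.
  - exact: leq_trans (ltnW lt) Ib.
  - move=> x; rewrite ltnS leq_eqVlt => /orP[/eqP->//|xj].
    by apply: leq_trans (ltnW lt) _; exact: Imin.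
  - by move=> _; exists j.
  - move=> y yn; move: (yn); rewrite !inE !negb_or => /and4P[/negPf-> /negPf-> _ _].
    exact: Iv.
  - by move=> x; rewrite ltnS leq_eqVlt => /orP[/eqP->//|xj]; exact: Imin.
  - by move=> /Iatt[x [xj ? ?]]; exists x; split=> //; exact: ltnW.
rewrite /I addn1 => -[Iv In Ib Imin Iatt].
have ec : vars body vCell = cell n i z by rewrite Iv.
have tabE z' : bounded n z' ->
    table (run n (Then (Put aTable (Var vCell) (Var vBest))
                       (Put aSucc (Var vCell) (Var vSucc))) body) i.+1 z' =
    table st i.+1 z'.
  by move=> bz'; rewrite /table !runE /= In ec other.
have bs x : x <= n -> bounded n (shift c z i x).
  by move=> xn; apply: bounded_shift => //; exact: ltnW.
rewrite !runE /= ec in tabE *; split.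
- by move=> e /negPf ne /=; rewrite ne In.
- by move=> e /negPf ne /=; rewrite ne In.
split=> [x xn|]; first rewrite tabE; last 2 first.
- exact: bs.
- rewrite {1}/table/= eqxx => /Iatt[x [xn e1 e2]]; exists x; split=> //.
    by rewrite /succ_cell /= eqxx.
  by rewrite {1}/table/= eqxx tabE ?e2//; exact: bs.
by rewrite {1}/table /= eqxx; exact: Imin.
Qed.

(* The cells of [D] stay optimal while the table is filled from the last position
   backwards, since they refer to positions after the current one only. *)
Definition filled (D : nat -> sweep -> Prop) st : Prop :=
  static st /\ forall i z, i <= n -> bounded n z -> D i z -> optimal_cell st i z.

Lemma fill_cellP D i z st :
  filled D st -> in_state st i z -> i <= n -> bounded n z ->
  (forall i' z', D i' z' -> i <= i' /\ (i', z') <> (i, z)) ->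
  filled (fun i' z' => D i' z' \/ (i', z') = (i, z)) (run n fill_cell st).
Proof.
move=> [sst dn] zst iN bz later; have [ei ez] := zst.
have [f1 f2 f3] : fills st (run n fill_cell st) i z.
  rewrite /fill_cell run_then run_set neval_cell [neval _ _ _]/= ei -ez.
  set st1 := set_var _ _ _.
  rewrite -[fills st]/(fills st1).
  have zst1 : in_state st1 i z by [].
  have sst1 : static st1 by [].
  have v1 y : y \in [:: vI; vA; vA'; vB; vB'] -> vars st1 y = vars st y.
    by rewrite /st1 /= /upd; case: eqP => // ->.
  have eI : neval n st1 (Var vI) = i by [].
  rewrite run_if beval_le eI [neval _ _ Size]/=; case: leqP => ni.
    have en : i == n by rewrite eqn_leq iN.
    have nz c : next_of c z = if c then vars st vB' else vars st vA'.
      by rewrite ez; case: c.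
    rewrite run_if beval_and !beval_le !runE /fills /optimal_at en !nz /table.
    rewrite /= addn1.
    by case: ifP => _; split=> [y /negPf ny|y|]; rewrite /= ?eqxx ?ny.
  have sideE : (narr st1 aSide i <= 0) = ~~ store_side i.
    by rewrite leqn0 negbK; case: sst => ->.
  rewrite run_if; have -> : beval n st1 (BLe (Get aSide (Var vI)) (Cst 0)) =
      ~~ store_side i by rewrite -sideE -eI.
  case: ifP => side_i;
    [apply: (branchP (c := false))|apply: (branchP (c := true))] => //.
  - exact/negbTE.
  - by rewrite ez.
  - move=> st' x Hv; rewrite neval_cell /= /upd /= !Hv// !v1// ei addn1.
    by rewrite ez.
  - exact/negbFE.
  - by rewrite ez.
  - move=> st' x Hv; rewrite neval_cell /= /upd /= !Hv// !v1// ei addn1.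
    by rewrite ez.
split.
  case: sst => e1 e2 e3; split; [by rewrite run_narr|by rewrite run_narr|].
  by rewrite -e3; apply/funext => a; rewrite run_rarr.
move=> i' z' i'N bz' [Dz|[-> ->//]].
have [ii' ne] := later _ _ Dz; have := dn _ _ i'N bz' Dz.
have tE w j : i <= j -> bounded n w -> (j, w) <> (i, z) ->
    table (run n fill_cell st) j w = table st j w.
  move=> ij bw jw; rewrite /table f1//; apply/eqP => /cell_inj[]// ? ?.
  by apply: jw; congr pair.
have sE w : succ_cell (run n fill_cell st) i' z' w = succ_cell st i' z' w.
  by rewrite /succ_cell f2//; apply/eqP => /cell_inj[]// ? ?; apply: ne; congr pair.
rewrite /optimal_at tE//; case: eqP => // i'n.
have tE' w : bounded n w -> table (run n fill_cell st) i'.+1 w = table st i'.+1 w.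
  by move=> bw; apply: tE => //; [exact: leqW|case; lia].
have bs c x : x <= n -> bounded n (shift c z' i' x).
  by move=> xn; apply: bounded_shift.
case: ifP => _; last by rewrite sE tE'.
move=> [le ex]; split=> [x xn|/ex[x [xn sx tx]]].
  by rewrite tE' ?le//; exact: bs.
by exists x; rewrite sE tE'//; exact: bs.
Qed.

Lemma filled_mono D D' st :
  (forall i z, i <= n -> bounded n z -> D' i z -> D i z) ->
  filled D st -> filled D' st.
Proof.
by move=> DD [sst dn]; split=> // i z iN bz /(DD _ _ iN bz); exact: dn.
Qed.

Definition pinned (ps : seq (nat * nat)) st : Prop :=
  all (fun p => vars st p.1 == p.2) ps.

(** Contract for a loop nest that fills the states of [blk] in row [i], the variables of the
    enclosing loops being fixed by [ps]; [D] may hold later rows and other parts of row [i]. The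
    contract is preserved by wrapping a loop around, so the four loops over a state are handled one
    at a time. *)
Definition fills_block ps i (blk : sweep -> Prop) s : Prop :=
  forall D st, pinned ps st -> filled D st ->
  (forall i' z, D i' z -> i <= i' /\ (i' = i -> ~ blk z)) ->
  filled (fun i' z => D i' z \/ i' = i /\ blk z) (run n s st).

Lemma fills_block_for ps i (blk : nat -> sweep -> Prop) x s :
  all (fun p => p.1 \notin x :: var_writes s) ps ->
  (forall j j' z, blk j z -> blk j' z -> j = j') ->
  (forall j, j <= n -> fills_block ((x, j) :: ps) i (blk j) s) ->
  fills_block ps i (fun z => exists2 j, j <= n & blk j z) (For 1 x s).
Proof.
move=> /allP psx blkI IHs D st pst fD later.
have pin st1 j : pinned ps st1 -> pinned ((x, j) :: ps) (set_var st1 x j).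
  move=> /allP p1; rewrite /pinned /= {1}/upd eqxx eqxx; apply/allP => p pp.
  have := psx p pp; rewrite inE negb_or /upd => /andP[/negPf-> _].
  exact: p1.
pose I j st1 := pinned ps st1 /\
  filled (fun i' z => D i' z \/ i' = i /\ exists2 j', j' < j & blk j' z) st1.
have : I (n + 1) (run n (For 1 x s) st).
  apply: run_for => [|j st1 jn [p1 f1]].
    by split=> //; apply: filled_mono fD => ? ? _ _ [//|[_ [? //]]].
  have jN : j <= n by lia.
  split.
    apply/allP => p pp; have := psx p pp; rewrite inE negb_or => /andP[px ps'].
    rewrite run_vars//; have /allP/(_ p) := pin _ j p1; apply.
    by rewrite inE pp orbT.
  apply: filled_mono (IHs j jN _ _ (pin _ j p1) f1 _).
    move=> i' z _ _ [Dz|[-> [j' + bj]]]; first by left; left.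
    rewrite ltnS leq_eqVlt => /orP[/eqP e|j'j].
      by right; split=> //; rewrite -e.
    by left; right; split=> //; exists j'.
  (* Blocks of different loop values are disjoint, so those already filled are admissible in [D]. *)
  move=> i' z [/later[ii' nb]|[-> [j' j'j bj']]].
    by split=> // /nb nb' bj; apply: nb'; exists j.
  by split=> // _ bj; have := blkI _ _ _ bj bj'; lia.
move=> [_]; apply: filled_mono => i' z _ _ [Dz|[-> [j' jn bj]]]; first by left.
by right; split=> //; exists j' => //; rewrite addn1 ltnS.
Qed.

Lemma fill_tableP st : static st -> filled (fun _ _ => True) (run n fill_table st).
Proof.
move=> sst.
have blockP i : i <= n -> fills_block [:: (vI, i)] i (bounded n)
    (For 1 vA (For 1 vA' (For 1 vB (For 1 vB' fill_cell)))).
  move=> iN.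
  have base a a' b b' : a <= n -> a' <= n -> b <= n -> b' <= n ->
      fills_block [:: (vB', b'); (vB, b); (vA', a'); (vA, a); (vI, i)] i
        (eq (a, a', b, b')) fill_cell.
    move=> an a'n bn b'n D st1; rewrite /pinned /=.
    move=> /and5P[/eqP eb' /eqP eb /eqP ea' /eqP ea].
    rewrite andbT => /eqP ei fD later.
    apply: filled_mono (fill_cellP (i := i) (z := (a, a', b, b')) fD _ _ _ _) => //.
    + by move=> ? ? _ _ [|[-> <-]]; [left|right].
    + by rewrite /in_state -eb' -eb -ea' -ea -ei.
    + by move=> i' z' /later[? nb]; split=> // -[/nb h /esym]; exact: h.
  have l4 a a' b : a <= n -> a' <= n -> b <= n ->
      fills_block [:: (vB, b); (vA', a'); (vA, a); (vI, i)] i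
        (fun z => exists2 b', b' <= n & (a, a', b, b') = z) (For 1 vB' fill_cell).
    move=> an a'n bn; apply: fills_block_for => //.
      by move=> j j' z <- [].
    by move=> j jn; exact: base.
  have l3 a a' : a <= n -> a' <= n ->
      fills_block [:: (vA', a'); (vA, a); (vI, i)] i
        (fun z => exists2 b, b <= n & exists2 b', b' <= n & (a, a', b, b') = z)
        (For 1 vB (For 1 vB' fill_cell)).
    move=> an a'n; apply: fills_block_for => //.
      by move=> j j' z [? _ <-] [? _ []].
    by move=> j jn; exact: l4.
  have l2 a : a <= n -> fills_block [:: (vA, a); (vI, i)] i
        (fun z => exists2 a', a' <= n & exists2 b, b <= n &
           exists2 b', b' <= n & (a, a', b, b') = z)
        (For 1 vA' (For 1 vB (For 1 vB' fill_cell))).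
    move=> an; apply: fills_block_for => //.
      by move=> j j' z [? _ [? _ <-]] [? _ [? _ []]].
    by move=> j jn; exact: l3.
  have l1 : fills_block [:: (vI, i)] i
        (fun z => exists2 a, a <= n & exists2 a', a' <= n & exists2 b, b <= n &
           exists2 b', b' <= n & (a, a', b, b') = z)
        (For 1 vA (For 1 vA' (For 1 vB (For 1 vB' fill_cell)))).
    apply: fills_block_for => //.
    by move=> j j' z [? _ [? _ [? _ <-]]] [? _ [? _ [? _ []]]].
  move=> D st1 p1 f1 later; apply: filled_mono (l1 D st1 p1 f1 _) => [i' z _ bz|].
    move=> [Dz|[-> _]]; [by left|right; split=> //].
    case: z bz => [[[a a'] b] b'] [/= an a'n bn b'n].
    by exists a => //; exists a' => //; exists b => //; exists b'.
  move=> i' z /later[ii' nb]; split=> // /nb nb' [a an [a' a'n [b bn [b' b'n e]]]].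
  by apply: nb'; rewrite -e.
(* After [j] iterations the last [j] of the [n + 1] rows are complete. *)
pose I j st1 := filled (fun i' _ => n < i' + j) st1.
have : I (n + 1) (run n fill_table st).
  apply: run_for => [|j st1 jn f1].
    by split=> // i z iN _; rewrite addn0 ltnNge iN.
  rewrite run_then run_set; set st2 := set_var _ _ _.
  have f2 : filled (fun i' _ => n < i' + j) st2 by [].
  have p2 : pinned [:: (vI, n - j)] st2 by rewrite /pinned /= /upd /= eqxx.
  apply: filled_mono (blockP _ (leq_subr _ _) _ _ p2 f2 _).
    move=> i z iN bz ij; have [ltn|] := ltnP n (i + j); first by left.
    by move=> le; right; split=> //; lia.
  by move=> i z ij; split; lia.
by apply: filled_mono => i z iN _ _; lia.
Qed.
End Fill.

(** * Reading a minimum selection off the table *)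

Section Extract.
Variables (R : realType) (n : nat) (st0 : store R).
Implicit Types (st : store R) (z : sweep).

Local Notation start a' b' := (n, a', n, b').

Lemma bounded_start a' b' : a' <= n -> b' <= n -> bounded n (start a' b').
Proof. by []. Qed.

Definition best_start (D : nat -> nat -> Prop) st : Prop :=
  [/\ narr st = narr st0, vars st vBest <= n.+1,
    (forall a' b', a' <= n -> b' <= n -> D a' b' ->
       vars st vBest <= table n st0 0 (start a' b')) &
    (vars st vBest <= n -> exists a' b', [/\ a' <= n, b' <= n,
       vars st vCell = cell n 0 (start a' b') &
       vars st vBest = table n st0 0 (start a' b')])].

Lemma best_start_mono D D' st :
  (forall a' b', a' <= n -> b' <= n -> D' a' b' -> D a' b') ->
  best_start D st -> best_start D' st.
Proof.
move=> DD [e b le ex]; split=> // a' b' a'n b'n /(DD _ _ a'n b'n); exact: le.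
Qed.

Lemma choose_startP st : narr st = narr st0 ->
  best_start (fun _ _ => True) (run n choose_start st).
Proof.
move=> e0; rewrite /choose_start run_then run_set.
pose I j st1 := best_start (fun a' _ => a' < j) st1.
suff : I (n + 1) (run n (For 1 vA' (For 1 vB' (Then
    (Set_ vTry (cell_exp (Cst 0) Size (Var vA') Size (Var vB')))
    (If (bLt (Get aTable (Var vTry)) (Var vBest))
      (Then (Set_ vBest (Get aTable (Var vTry))) (Set_ vCell (Var vTry))) Nop))))
    (set_var st vBest (neval n st (nSucc Size)))).
  by apply: best_start_mono => a' b' a'n b'n _; lia.
apply: run_for => [|j st1 jn I1].
  by split; rewrite //= /upd /= addn1// ltnn.
(* The starts tried so far are those lexicographically below [(j, k)]. *)
pose J k st2 := vars st2 vA' = j /\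
  best_start (fun a' b' => a' < j \/ a' = j /\ b' < k) st2.
suff : J (n + 1) (run n (For 1 vB' (Then
    (Set_ vTry (cell_exp (Cst 0) Size (Var vA') Size (Var vB')))
    (If (bLt (Get aTable (Var vTry)) (Var vBest))
      (Then (Set_ vBest (Get aTable (Var vTry))) (Set_ vCell (Var vTry))) Nop)))
    (set_var st1 vA' j)).
  by move=> [_]; apply: best_start_mono => a' b' a'n b'n; lia.
apply: run_for => [|k st2 kn [ej [e2 b2 le2 ex2]]].
  split; first by rewrite /= /upd eqxx.
  have [? ? le1 ex1] := I1; split=> //.
  by move=> a' b' a'n b'n [|[_ //]]; exact: le1.
rewrite run_then run_set neval_cell.
have -> : cell n (neval n (set_var st2 vB' k) (Cst 0))
   (neval n (set_var st2 vB' k) Size, neval n (set_var st2 vB' k) (Var vA'),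
    neval n (set_var st2 vB' k) Size, neval n (set_var st2 vB' k) (Var vB')) =
    cell n 0 (start j k) by rewrite /= /upd /= ej.
rewrite run_if beval_lt /= /upd /= e2 -/(table n st0 0 (start j k)).
rewrite !runE; case: ltnP => lt.
  split; first by rewrite /= /upd /=.
  split; rewrite /= /upd /= ?e2 -?/(table n st0 0 (start j k)) //.
  - exact: leq_trans (ltnW lt) b2.
  - move=> a' b' a'n b'n h.
    have [[-> ->]//|ne] : (a', b') = (j, k) \/ (a', b') <> (j, k) by exact: EM.
    apply: leq_trans (ltnW lt) _; apply: le2 => //.
    case: h => [|[aj]]; [by left|rewrite ltnS leq_eqVlt => /orP[/eqP bk|]].
      by case: ne; rewrite aj bk.
    by right.
  - by move=> _; exists j, k; split=> //; lia.
split; first by rewrite /= /upd /=.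
split; rewrite /= /upd //=.
move=> a' b' a'n b'n h.
have [[-> ->]//|ne] : (a', b') = (j, k) \/ (a', b') <> (j, k) by exact: EM.
apply: le2 => //.
case: h => [|[aj]]; [by left|rewrite ltnS leq_eqVlt => /orP[/eqP bk|]].
  by case: ne; rewrite aj bk.
by right.
Qed.

Local Notation tab := (table n st0).

Lemma read_offP (zs : nat -> sweep) st :
  narr st = narr st0 -> vars st vCell = cell n 0 (zs 0) ->
  (forall i, i < n -> succ_cell n st0 i (zs i) (zs i.+1)) ->
  (forall i j, i < n -> j < n -> narr st0 aPerm i = narr st0 aPerm j -> i = j) ->
  (forall i, i < n -> narr st0 aOut (narr st0 aPerm i) = 0) ->
  forall i, i < n ->
    (narr (run n read_off st) aOut (narr st0 aPerm i) != 0) = chosen tab zs i.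
Proof.
move=> e0 c0 sc pinj out0.
pose I j st1 := [/\ vars st1 vCell = cell n j (zs j),
  [/\ narr st1 aTable = narr st0 aTable, narr st1 aSucc = narr st0 aSucc
    & narr st1 aPerm = narr st0 aPerm] &
  forall i, i < n -> (narr st1 aOut (narr st0 aPerm i) != 0) =
    (i < j) && chosen tab zs i].
suff : I (n + 0) (run n read_off st).
  by rewrite addn0 => -[_ _ h] i iN; rewrite h// iN.
apply: run_for => [|j st1]; first by split=> //= [|i iN]; rewrite e0// out0.
rewrite addn0 => jN [ec [et es ep] eo].
rewrite !runE beval_le /= /upd /= et es ep ec.
have -> : narr st0 aSucc (cell n j (zs j)) = cell n j.+1 (zs j.+1) by exact: sc.
rewrite -!/(tab _ _) leqNgt -/(chosen tab zs j).
have ne i : i < n -> narr st0 aPerm i == narr st0 aPerm j = (i == j).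
  by move=> iN; apply/eqP/eqP => [/pinj|->]//; exact.
case: ifP => [/negPf|/negbFE] cj; split=> //= i iN.
  rewrite eo//; rewrite ltnS [i <= j]leq_eqVlt.
  by case: (eqVneq i j) => // ->; rewrite cj !andbF.
rewrite ne// ltnS [i <= j]leq_eqVlt.
by case: (eqVneq i j) => [->|_]; rewrite ?cj// eo.
Qed.

End Extract.

Section Solve.
Variables (R : realType) (n : nat) (st : store R).

Local Notation side := (store_side st).
Local Notation col := (store_col st).
Local Notation sqdist := (store_sqdist n st).

Hypothesis near : forall p r s, p < n -> r < n -> s < n -> side r = side s ->
  (s < r < p) || (p < r < s) -> (sqdist p r < sqdist p s)%R.
Hypothesis perm_inj : forall i j, i < n -> j < n ->
  narr st aPerm i = narr st aPerm j -> i = j.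
Hypothesis out0 : forall i, i < n -> narr st aOut (narr st aPerm i) = 0.

Lemma sweep_correct : exists S : pred nat,
  [/\ all_served n col sqdist S,
    (forall S', all_served n col sqdist S' ->
       count S (iota 0 n) <= count S' (iota 0 n)) &
    forall i, i < n ->
      (narr (run n read_off (run n choose_start (run n fill_table st)))
         aOut (narr st aPerm i) != 0) = S i].
Proof.
have [_ opt] := fill_tableP n (st0 := st) (And3 erefl erefl erefl).
set st1 := run n fill_table st in opt *.
have {}opt i z : i <= n -> bounded n z -> optimal_at n side col sqdist
    (table n st1) (succ_cell n st1) i z by move=> iN bz; exact: opt.
have le_opt S' : all_served n col sqdist S' ->
    table n st1 0 (trail n side S' 0) <= count S' (iota 0 n).
  by move=> serv; have := optimal_le near opt serv (leq0n n); rewrite subn0.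
have [e2 b2 le2 ex2] := choose_startP n (st0 := st1) erefl.
set st2 := run n choose_start st1 in e2 b2 le2 ex2 *.
have le_best S' : all_served n col sqdist S' ->
    vars st2 vBest <= count S' (iota 0 n).
  move=> serv; apply: leq_trans (le_opt _ serv).
  by apply: le2 => //; exact: after_le.
(* Selecting every position leaves nothing to serve, so the optimum is at most [n] and some start
   has finite cost. *)
have bn : vars st2 vBest <= n.
  have := le_best xpredT; rewrite count_predT size_iota; apply.
  by move=> p pn.
have [a' [b' [a'n b'n ec eb]]] := ex2 bn.
have bz := bounded_start a'n b'n.
have := optimal_path opt bz; rewrite -eb => /(_ bn)[zs [z0 zsb zsS]].
have zb i : i <= n -> bounded n (zs i) by move=> /zsb[].
have zT i : i <= n -> table n st1 i (zs i) <= n by move=> /zsb[].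
have zp c : prev_of c (zs 0) = n by rewrite z0; case: c.
have zs1 i (iN : i < n) := (zsS i iN).2.
exists (chosen (table n st1) zs); split.
- exact: (path_served near opt zb zT zp zs1).
- move=> S' /le_best; rewrite eb -z0.
  by rewrite (path_count opt zb zT zs1)// subn0.
- have eP : narr st1 aPerm = narr st aPerm by rewrite run_narr.
  have eO : narr st1 aOut = narr st aOut by rewrite run_narr.
  rewrite -eP; apply: read_offP => //.
  + by rewrite ec z0.
  + by move=> i /zsS[].
  + by rewrite eP.
  + by move=> i iN; rewrite eP eO out0.
Qed.

End Solve.

Lemma card_count n (p : pred nat) : #|[set k : 'I_n | p k]| = count p (iota 0 n).
Proof.
rewrite cardsE cardE /enum_mem size_filter -enumT -val_enum_ord count_map.
by [].
Qed.

(** * Sorted positions as ranks *)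

Section Ranking.
Variables (R : realType) (n : nat) (T : nat -> R).

Definition earlier (j i : nat) : bool :=
  ~~ (T i <= T j)%R || ((T j <= T i)%R && (j < i)).

Lemma earlier_le j i : earlier j i -> (T j <= T i)%R.
Proof. by case/orP => [|/andP[]//]; rewrite -ltNge => /ltW. Qed.

Lemma earlier_irr i : earlier i i = false.
Proof. by rewrite /earlier lexx ltnn andbF. Qed.

Lemma earlier_trans : transitive earlier.
Proof.
move=> j i k; rewrite /earlier -!ltNge.
case/orP => [ij|/andP[ij ji]]; case/orP => [jk|/andP[jk kj]].
- by rewrite (lt_trans ij jk).
- by rewrite (lt_le_trans ij jk).
- by rewrite (le_lt_trans ij jk).
- by rewrite (le_trans ij jk) (ltn_trans ji kj) orbT.
Qed.

Lemma earlier_total i j : i != j -> earlier i j || earlier j i.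
Proof.
move=> ij; rewrite /earlier -!ltNge; case: (ltgtP (T i) (T j)) => //= _.
by rewrite -neq_ltn.
Qed.

Definition position i : nat := count (earlier^~ i) (iota 0 n).

(** [earlier] is a strict total order: if [j] precedes [i], the predecessors of [j] form a proper
    subset of those of [i], which contain [j] itself. *)
Lemma position_lt j i : i < n -> j < n -> (position j < position i) = earlier j i.
Proof.
have mono a b : a < n -> earlier a b -> position a < position b.
  move=> an ab; rewrite /position -!card_count; apply: proper_card.
  apply/properP; split.
    by apply/fintype.subsetP => k; rewrite !inE => /earlier_trans; apply.
  by exists (Ordinal an); rewrite !inE//= earlier_irr.
move=> iN jN; apply/idP/idP => [lt|]; last exact: mono.
have [e|ne] := eqVneq i j; first by rewrite e ltnn in lt.
by have /orP[/(mono _ _ iN)|//] := earlier_total ne; lia.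
Qed.

Lemma position_bound i : i < n -> position i < n.
Proof.
move=> iN; rewrite /position -card_count.
apply: (@leq_trans #|[set: 'I_n]|); last by rewrite cardsT card_ord.
apply: proper_card; apply/properP; split; first exact: finset.subsetT.
by exists (Ordinal iN); rewrite !inE //= earlier_irr.
Qed.

Lemma position_inj i j : i < n -> j < n -> position i = position j -> i = j.
Proof.
move=> iN jN e; apply/eqP; apply: contraT => /earlier_total.
by rewrite -!position_lt// e ltnn.
Qed.

Definition pos_ord (i : 'I_n) : 'I_n := Ordinal (position_bound (ltn_ord i)).

Lemma pos_ord_inj : injective pos_ord.
Proof.
move=> i j /(congr1 val) /= e; apply: val_inj; exact: position_inj e.
Qed.

Lemma position_surj p : p < n -> exists i : 'I_n, p = position i.
Proof.
move=> pn; have [f _ fK] := injF_bij pos_ord_inj.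
by exists (f (Ordinal pn)); have /(congr1 val) := fK (Ordinal pn).
Qed.

End Ranking.

(** * Correctness of the preprocessing *)

Section Sorting.
Variables (R : realType) (n : nat).
Implicit Types (st : store R).

Lemma project_pointsP st k : k < n ->
  let nrm := rarr st aNormal in
  rarr (run n project_points st) aT k =
    (nrm 0 * rarr st aY k - nrm 1 * rarr st aX k)%R /\
  rarr (run n project_points st) aH k =
    (nrm 0 * rarr st aX k + nrm 1 * rarr st aY k)%R.
Proof.
move=> kn nrm.
pose I j st1 := [/\ rarr st1 aNormal = nrm, rarr st1 aX = rarr st aX,
  rarr st1 aY = rarr st aY & forall k, k < j ->
  rarr st1 aT k = (nrm 0 * rarr st aY k - nrm 1 * rarr st aX k)%R /\
  rarr st1 aH k = (nrm 0 * rarr st aX k + nrm 1 * rarr st aY k)%R].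
suff : I (n + 0) (run n project_points st) by move=> [_ _ _]; apply; rewrite addn0.
apply: run_for => // j st1 _ [en ex ey e]; rewrite !runE; split=> //= i.
rewrite /upd eqxx en ex ey ltnS leq_eqVlt.
by case: (eqVneq i j) => [->//|_ /= ij]; exact: e.
Qed.

Lemma rank_pointP st :
  vars (run n rank_point st) vX = position n (rarr st aT) (vars st vI).
Proof.
rewrite /rank_point run_then run_set.
pose I j st1 := [/\ vars st1 vI = vars st vI, rarr st1 = rarr st &
  vars st1 vX = count (earlier (rarr st aT) ^~ (vars st vI)) (iota 0 j)].
set st1 := set_var _ _ _.
suff : I (n + 0) (run n (For 0 vJ
  (If (bOr (BNot (BRle (RGet aT (Var vI)) (RGet aT (Var vJ))))
           (BAnd (BRle (RGet aT (Var vJ)) (RGet aT (Var vI)))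
                 (bLt (Var vJ) (Var vI))))
    (Set_ vX (nSucc (Var vX))) Nop)) st1).
  by rewrite addn0 => -[_ _ ->].
apply: run_for => // j st2 _ [ei er ex].
rewrite run_if beval_or beval_and beval_not !beval_rle beval_lt /= /upd /= er ei.
rewrite -/(earlier _ _ _) !runE.
have iotaS : iota 0 j.+1 = iota 0 j ++ [:: j] by rewrite -addn1 iotaD.
split; rewrite ?iotaS ?count_cat /=; case: ifP => _; rewrite //= /upd /=;
  by rewrite ex !addn0.
Qed.

Lemma sort_pointsP st : let t := rarr st aT in let st' := run n sort_points st in
  forall i, i < n ->
  [/\ narr st' aPerm (position n t i) = i,
      narr st' aSortedCol (position n t i) = narr st aCol i,
      rarr st' aSortedT (position n t i) = t i &
      rarr st' aSortedH (position n t i) = rarr st aH i].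
Proof.
move=> t st'.
pose I j st1 := [/\ rarr st1 aT = t, rarr st1 aH = rarr st aH,
  narr st1 aCol = narr st aCol & forall i, i < j ->
  [/\ narr st1 aPerm (position n t i) = i,
      narr st1 aSortedCol (position n t i) = narr st aCol i,
      rarr st1 aSortedT (position n t i) = t i &
      rarr st1 aSortedH (position n t i) = rarr st aH i]].
suff : I (n + 0) st' by rewrite addn0 => -[].
apply: run_for => // j st1; rewrite addn0 => jN [et eh ec e].
rewrite run_then; set st2 := run n rank_point _.
have e2 : vars st2 vX = position n t j by rewrite rank_pointP /= et /upd eqxx.
have i2 : vars st2 vI = j by rewrite run_vars//= /upd eqxx.
have n2 : narr st2 = narr st1 by apply/funext => a; rewrite run_narr.
have r2 : rarr st2 = rarr st1 by apply/funext => a; rewrite run_rarr.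
rewrite !runE; split=> //=; rewrite ?r2 ?n2 //.
rewrite e2 i2 et eh ec => i; rewrite ltnS leq_eqVlt.
case: (eqVneq i j) => [->|ne] /=; first by rewrite eqxx.
move=> ij; have -> : (position n t i == position n t j) = false.
  apply/eqP => /position_inj/eqP; rewrite (negPf ne).
  by rewrite (ltn_trans ij jN) jN => /(_ erefl erefl).
exact: e.
Qed.

Lemma classify_pointsP st : let h := rarr st aSortedH in
  let st' := run n classify_points st in
  forall i, i < n -> narr st' aOut i = 0 /\
    (narr st' aSide i != 0) = (h i != h 0).
Proof.
move=> h st'.
pose I j st1 := rarr st1 = rarr st /\ forall i, i < j ->
  narr st1 aOut i = 0 /\ (narr st1 aSide i != 0) = (h i != h 0).
suff : I (n + 0) st' by rewrite addn0 => -[].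
apply: run_for => // j st1 jN [er e].
rewrite run_then run_put run_if beval_and !beval_rle /= /upd /= er -/h -eq_le.
rewrite !runE; case: eqVneq => hj; split=> //= i; rewrite ltnS leq_eqVlt;
  rewrite /upd /=; case: (eqVneq i j) => [->|ne] //= ij.
- by rewrite hj eqxx.
- exact: e.
- exact: e.
Qed.

End Sorting.

(** * From points on two lines to the sweep *)

Section Correctness.
Variables (R : realType) (n : nat) (I : instance R n).
Hypothesis Ilines : on_two_parallel_lines I.
Implicit Types (i j : 'I_n) (A : {set 'I_n}).

Definition tcoord i : R := (nx I * (pos I i).2 - ny I * (pos I i).1)%R.
Definition hcoord i : R := (nx I * (pos I i).1 + ny I * (pos I i).2)%R.
Definition sqdist i j : R :=
  ((tcoord i - tcoord j) * (tcoord i - tcoord j) +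
   (hcoord i - hcoord j) * (hcoord i - hcoord j))%R.

Lemma normal_gt0 : (0 < nx I * nx I + ny I * ny I)%R.
Proof.
have [_ + _ _] := Ilines; rewrite xpair_eqE negb_and -!expr2 => nz.
rewrite lt_neqAle addr_ge0 ?sqr_ge0// andbT eq_sym paddr_eq0 ?sqr_ge0//.
by rewrite !sqrf_eq0 negb_and.
Qed.

(* Lengths get multiplied by that of the normal vector. *)
Lemma sqdist_edist i j k :
  (Defs.edist (pos I i) (pos I j) <= Defs.edist (pos I i) (pos I k))%R =
  (sqdist i j <= sqdist i k)%R.
Proof.
have scale u v : sqdist u v = ((nx I * nx I + ny I * ny I) *
    (((pos I u).1 - (pos I v).1) ^+ 2 + ((pos I u).2 - (pos I v).2) ^+ 2))%R.
  by rewrite /sqdist /tcoord /hcoord; ring.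
rewrite !scale ler_pM2l ?normal_gt0// /Defs.edist.
by rewrite ler_psqrt// nnegrE addr_ge0 ?sqr_ge0.
Qed.

(** The change of coordinates is linear and its determinant is, up to sign, the squared length of
    the normal; the identities below invert it up to that factor. *)
Lemma coords_inj i j : tcoord i = tcoord j -> hcoord i = hcoord j -> i = j.
Proof.
move=> et eh; have [+ _ _ _] := Ilines; apply.
have n0 := normal_gt0.
have n1 : (nx I * nx I + ny I * ny I != 0)%R by rewrite gt_eqF.
move: et eh; rewrite /tcoord /hcoord.
case: (pos I i) (pos I j) => [x y] [x' y'] /= et eh.
congr pair; apply: (mulfI n1).
  have -> : ((nx I * nx I + ny I * ny I) * x =
    nx I * (nx I * x + ny I * y) - ny I * (nx I * y - ny I * x))%R by ring.
  by rewrite et eh; ring.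
have -> : ((nx I * nx I + ny I * ny I) * y =
  ny I * (nx I * x + ny I * y) + nx I * (nx I * y - ny I * x))%R by ring.
by rewrite et eh; ring.
Qed.

Lemma hcoord_two i j k : hcoord i != hcoord k -> hcoord j != hcoord k ->
  hcoord i = hcoord j.
Proof.
have [_ _ _ h] := Ilines; rewrite /hcoord.
by have [->|->] := h i; have [->|->] := h j; have [->|->] := h k; rewrite ?eqxx.
Qed.

(** The contributions across the lines cancel. The inequalities are weak because [i] may face [j]
    from the other line; strictness comes from [j] and [k] being distinct points of one line. *)
Lemma sqdist_lt i j k : j != k -> hcoord j = hcoord k ->
  (tcoord k <= tcoord j <= tcoord i)%R || (tcoord i <= tcoord j <= tcoord k)%R ->
  (sqdist i j < sqdist i k)%R.
Proof.
move=> jk hjk; have tjk : tcoord j != tcoord k.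
  by apply: contra jk => /eqP e; apply/eqP; exact: coords_inj.
rewrite /sqdist hjk ltrD2r.
case/orP => /andP[le1 le2].
  have {}le1 : (tcoord k < tcoord j)%R by rewrite lt_neqAle eq_sym tjk.
  by apply: ltr_pM; lra.
have {}le2 : (tcoord j < tcoord k)%R by rewrite lt_neqAle tjk.
by rewrite -[ltLHS]mulrNN -[ltRHS]mulrNN; apply: ltr_pM; lra.
Qed.

Definition loaded (st : store R) : Prop :=
  [/\ forall i, narr st aCol i = color I i,
      forall i, rarr st aX i = (pos I i).1,
      forall i, rarr st aY i = (pos I i).2 &
      rarr st aNormal 0 = nx I /\ rarr st aNormal 1 = ny I].

Lemma solve_correct st : loaded st ->
  minimum_consistent I [set i : 'I_n | narr (run n solve st) aOut i != 0].
Proof.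
move=> [lc lx ly [lnx lny]].
set st1 := run n project_points st; set st2 := run n sort_points st1.
set st3 := run n classify_points st2.
have c1 : narr st1 = narr st by apply/funext => a; rewrite run_narr.
have t1 i : rarr st1 aT i = tcoord i.
  by have [-> _] := project_pointsP st (ltn_ord i); rewrite lnx lny lx ly.
have h1 i : rarr st1 aH i = hcoord i.
  by have [_ ->] := project_pointsP st (ltn_ord i); rewrite lnx lny lx ly.
pose rk := position n (rarr st1 aT).
have rkn i : rk i < n := position_bound (rarr st1 aT) (ltn_ord i).
have rk_inj i j : rk i = rk j -> i = j.
  by move=> /(position_inj (ltn_ord i) (ltn_ord j)) /val_inj.
have rk_surj p : p < n -> exists i : 'I_n, p = rk i := @position_surj _ n _ p.
have s2 i := sort_pointsP st1 (ltn_ord i).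
have c3 (q : nat) : q < n -> _ := @classify_pointsP _ n st2 q.
have perm3 i : narr st3 aPerm (rk i) = i by rewrite run_narr//; have [->] := s2 i.
have col3 i : store_col st3 (rk i) = color I i.
  by rewrite /store_col run_narr//; have [_ -> _ _] := s2 i; rewrite c1.
have rarr3 : rarr st3 = rarr st2 by apply/funext => a; rewrite run_rarr.
have t3 i : rarr st3 aSortedT (rk i) = tcoord i.
  by rewrite rarr3; have [_ _ -> _] := s2 i.
have h3 i : rarr st3 aSortedH (rk i) = hcoord i.
  by rewrite rarr3; have [_ _ _ ->] := s2 i; rewrite h1.
have sq3 i j : store_sqdist n st3 (rk i) (rk j) = sqdist i j.
  by rewrite /store_sqdist /= !t3 !h3.
have near p r s : p < n -> r < n -> s < n -> store_side st3 r = store_side st3 s ->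
    (s < r < p) || (p < r < s) ->
    (store_sqdist n st3 p r < store_sqdist n st3 p s)%R.
  move=> pn rn sn.
  (* The point at position 0, whose line is side 0; it exists because [p < n]. *)
  have [m m0] : exists m : 'I_n, 0 = rk m by apply: rk_surj; lia.
  have [i ->] := rk_surj p pn; have [j ->] := rk_surj r rn.
  have [k ->] := rk_surj s sn; rewrite !sq3 /store_side.
  have [_ ->] := c3 _ (rkn j); have [_ ->] := c3 _ (rkn k).
  have hm : rarr st3 aSortedH 0 = hcoord m by rewrite -(h3 m) -m0.
  rewrite -rarr3 hm !h3 => ejk ord.
  have le (u v : 'I_n) : rk u < rk v -> (tcoord u <= tcoord v)%R.
    by rewrite /rk position_lt// => /earlier_le; rewrite !t1.
  apply: sqdist_lt.
  - by apply/eqP => jk; rewrite jk !ltnn andbF in ord.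
  (* Equal sides mean that [j] and [k] are both on the line of [m] or both off it, and then they
     share the other line. *)
  - have [ej|nj] := eqVneq (hcoord j) (hcoord m).
      by move: ejk; rewrite ej eqxx => /esym/negbFE/eqP.
    by apply: (@hcoord_two _ _ m) => //; rewrite -ejk.
  - by case/orP: ord => /andP[/le-> /le->]; rewrite ?orbT.
have pinj p q : p < n -> q < n -> narr st3 aPerm p = narr st3 aPerm q -> p = q.
  move=> /rk_surj[i ->] /rk_surj[j ->]; rewrite !perm3.
  by move=> /val_inj ->.
have out0 p : p < n -> narr st3 aOut (narr st3 aPerm p) = 0.
  by move=> /rk_surj[i ->]; rewrite perm3; have [] := c3 i (ltn_ord i).
have servE (S : pred nat) : consistent I [set i : 'I_n | S (rk i)] <->
    all_served n (store_col st3) (store_sqdist n st3) S.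
  split=> [cS p /rk_surj[i ->] nS|sS i].
    have [|j [+ jmin] ji] := cS i; first by rewrite inE.
    rewrite inE => Sj; exists (rk j); split=> //; first by rewrite !col3.
    move=> r /rk_surj[k ->] Sk; rewrite !sq3 -sqdist_edist.
    by apply: jmin; rewrite inE.
  rewrite inE => /(sS _ (rkn i))[s [/rk_surj[j ->] Sj ji jmin]].
  exists j; last by rewrite -!col3.
  split; first by rewrite inE.
  by move=> k; rewrite inE sqdist_edist -!sq3 => Sk; exact: jmin.
have cardE (S : pred nat) :
    #|[set i : 'I_n | S (rk i)]| = count S (iota 0 n).
  rewrite -card_count -(card_imset _ (@pos_ord_inj _ n (rarr st1 aT))).
  congr #|pred_of_set _|; apply/setP => p; rewrite inE; apply/imsetP/idP.
    by move=> [i]; rewrite inE => Si ->.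
  move=> Sp; have [i e] := rk_surj p (ltn_ord p).
  by exists i; [rewrite inE -e|apply: val_inj].
have [S [serv mini outS]] := sweep_correct near pinj out0.
have -> : [set i : 'I_n | narr (run n solve st) aOut i != 0] =
    [set i : 'I_n | S (rk i)].
  by apply/setP => i; rewrite !inE -outS// perm3.
split; first exact/servE.
move=> A cA; pose S' p := [exists i in A, rk i == p].
have eA : A = [set i : 'I_n | S' (rk i)].
  apply/setP => i; rewrite inE.
  apply/idP/existsP => [iA|[j /andP[jA /eqP/rk_inj <-]]//].
  by exists i; rewrite iA eqxx.
by rewrite eA !cardE; apply: mini; apply/servE; rewrite -eA.
Qed.

End Correctness.

(** * Input, output and running time *)

(* All registers initially hold part of the input, so the colors in cells 1 to
   63 first move to the array [aCol].  It starts at address [64 * n] because this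
   can be computed in cell 0 alone, without knowing any free cell. *)
Definition enlarge : cmd :=
  prims (nseq 6 (NOp NAdd 0 0 0) ++ [:: NStore 0 1; NConst 1 0]).

(** Cell 0 is a moving pointer and cell 1 its increment, so the copy needs no further register. *)
Definition stash_prims (k : nat) : seq instr :=
  flatten [seq [:: NOp NAdd 0 0 1; NStore 0 j] | j <- iota 2 k].

Definition stash : cmd :=
  Seq (Prim (NConst 1 stride)) (Seq (prims (stash_prims 62))
    (prims [:: NConst 1 (stride * 62); NOp NSub 0 0 1;
               NConst 1 2; NOp NAdd 1 0 1; RStore 1 0;
               NConst 1 (stride + 2); NOp NAdd 1 0 1; RStore 1 1;
               NConst 1 0; NConst 2 0])).

(** Cell 0 holds [64 * n] and [n] itself is lost, so cell 2 counts in steps of 64 beside the index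
    in cell 1; on exit cell 1 holds [n], as compiled code expects. Colors are copied from index 63
    on, the earlier ones being stashed already. *)
Definition load_point : cmd :=
  Seq (Prim (NConst 3 63))
  (Seq (Ifte (NLe 3 1)
    (prims [:: NConst 5 stride; NOp NMul 4 1 5; NOp NAdd 4 0 4;
               NConst 5 1; NOp NAdd 5 1 5; NLoad 5 5; NStore 4 5]) Skip)
  (prims [:: NConst 5 stride; NOp NMul 4 1 5; NOp NAdd 4 0 4;
             NOp NAdd 5 1 1; NConst 6 4; NOp NAdd 5 5 6;
             RLoad 0 5; RStore 4 0;
             NConst 6 1; NOp NAdd 5 5 6; NOp NAdd 4 4 6;
             RLoad 0 5; RStore 4 0;
             NOp NAdd 1 1 6; NConst 6 64; NOp NAdd 2 2 6])).

(** Outputs from index 63 on go to cells from 64 on, so this loop cannot overwrite its own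
    registers. *)
Definition unload_point : cmd :=
  prims [:: NConst 3 stride; NOp NMul 3 2 3; NOp NAdd 3 0 3; NLoad 3 3;
            NConst 4 1; NOp NAdd 2 2 4; NStore 2 3].

(** The first 63 outputs overwrite the registers, so they come last, with cells 0 and 1 as the only
    working cells. The descending order brings the pointer back to the base, whose entry belongs in
    cell 1. *)
Definition restore_prims (k : nat) : seq instr :=
  flatten [seq [:: NLoad j 0; NOp NSub 0 0 1] | j <- rev (iota 2 k)].

Definition restore : cmd :=
  Seq (prims [:: NConst 1 (stride * 62); NOp NAdd 0 0 1; NConst 1 stride])
    (Seq (prims (restore_prims 62)) (Prim (NLoad 1 0))).

(** After [enlarge] the test [NLe 0 1] holds only for [n = 0], where the base address would not
    clear the registers. *)
Definition mcs_main : cmd :=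
  Seq enlarge (Ifte (NLe 0 1) Skip
    (Seq stash (Seq (While 2 0 load_point) (Seq (cstm 2 solve)
      (Seq (Seq (Prim (NConst 2 63)) (While 2 1 unload_point)) restore))))).

Lemma mcs_main_nesting : nesting mcs_main = 6. Proof. by vm_compute. Qed.

Ltac skip_cell := case: eqP => [|_]; first by lia.

(** * Relocation of input and output *)

Section Machine.
Variables (R : realType) (n : nat).
Hypothesis n_gt0 : 0 < n.
Local Notation B := (64 * n).
Local Notation adr := (addr B).
Local Notation k := n.+1.
Implicit Types (m : mem R).

Lemma addrE a j : adr a j = B + (16 * j + a). Proof. by []. Qed.

Lemma stash_primsP m j0 : j0 < 63 -> m.1 0 = B -> m.1 1 = stride ->
  let m' := foldl (fun m i => exec_prim i m) m (stash_prims j0) in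
  [/\ m'.1 0 = adr 0 j0, m'.1 1 = stride /\ m'.2 = m.2,
      (forall x, 1 < x < B -> m'.1 x = m.1 x), m'.1 B = m.1 B &
      (forall j, 0 < j <= j0 -> m'.1 (adr 0 j) = m.1 j.+1)].
Proof.
move=> + m0 m1; elim: j0 => [|j0 IH] j62 m'.
  by split=> //=; rewrite ?m0 ?addrE//; lia.
have [e0 [e1 e2] eN eB eA] := IH (ltnW j62).
rewrite /m' /stash_prims -[j0.+1]addn1 iotaD map_cat flatten_cat foldl_cat.
rewrite -/(stash_prims j0); move: (foldl _ _ _) e0 e1 e2 eN eB eA => m2.
rewrite /= !addrE /exec_prim /= addn0 => e0 e1 e2 eN eB eA; rewrite e0 e1.
rewrite /stride in e1 *.
have e : B + 16 * j0 + 16 = B + (16 * (j0 + 1)) by lia.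
rewrite e; split.
- by rewrite addn0; case: eqP => [|_]; lia.
- by split=> //; case: eqP => [|_]; lia.
- move=> x xB; case: eqP => [|_]; first by lia.
  by case: eqP => [|_]; [lia|exact: eN].
- case: eqP => [|_]; first by lia.
  by case: eqP => [|_]; [lia|exact: eB].
- move=> j /andP[j1 j2]; rewrite addrE addn0.
  have [ej|nj] := eqVneq j (j0 + 1).
    by rewrite ej eqxx eN; [congr (m.1 _)|]; lia.
  case: eqP => [|_]; first by lia.
  case: eqP => [|_]; first by lia.
  by have := eA j; rewrite addrE addn0; apply; lia.
Qed.

Lemma restore_primsP m j0 : j0 < 63 -> m.1 0 = adr 0 j0 -> m.1 1 = stride ->
  let m' := foldl (fun m i => exec_prim i m) m (restore_prims j0) in
  [/\ m'.1 0 = B, (forall x, 0 < x -> (x < 2) || (j0.+1 < x) -> m'.1 x = m.1 x) &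
      (forall j, 0 < j <= j0 -> m'.1 j.+1 = m.1 (adr 0 j))].
Proof.
elim: j0 m => [|j0 IH] m j62 m0 m1 m'.
  by split=> //=; rewrite ?m0 ?addrE//; lia.
have rE : restore_prims j0.+1 =
    [:: NLoad j0.+2 0; NOp NSub 0 0 1] ++ restore_prims j0.
  by rewrite /restore_prims -{1}[j0.+1]addn1 iotaD rev_cat.
rewrite /m' rE foldl_cat; set m2 := foldl _ m _.
have e0 : m2.1 0 = adr 0 j0.
  by rewrite /m2 /= m0 m1 !addrE /stride; lia.
have e1 : m2.1 1 = stride by [].
have eX x : 0 < x -> m2.1 x = if x == j0.+2 then m.1 (adr 0 j0.+1) else m.1 x.
  move=> x0; rewrite /m2 /exec_prim /= m0.
  by have -> : (x == 0) = false by lia.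
have [f0 fX fA] := IH m2 (ltnW j62) e0 e1; split=> //.
- move=> x x0 xj; rewrite fX//; last by lia.
  by rewrite eX//; case: eqP => // ?; lia.
- move=> j jj; have [ej|nj] := eqVneq j j0.+1.
    by rewrite ej fX ?eX ?eqxx//; lia.
  rewrite fA; last by lia.
  rewrite eX; last by rewrite addrE; lia.
  by case: eqP => // e; exfalso; move: e; rewrite addrE; lia.
Qed.

Variables (N0 : nat -> nat) (M0 : nat -> R).

Definition stashed m : Prop :=
  [/\ m.1 0 = B, (forall x, 63 < x < B -> m.1 x = N0 x),
      (forall j, j < 63 -> m.1 (adr 0 j) = N0 j.+1),
      (forall x, 3 < x < B -> m.2 x = M0 x) &
      m.2 (adr 2 0) = M0 0 /\ m.2 (adr 2 1) = M0 1].

Lemma stashP m : m.1 0 = B -> (forall x, 1 < x < B -> m.1 x = N0 x) ->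
  m.1 B = N0 1 -> m.2 = M0 ->
  wp k stash (fun m' => [/\ stashed m', m'.1 1 = 0 & m'.1 2 = 0]) m.
Proof.
move=> m0 mN mB m2.
apply: wp_seq; apply: wp_prim => //; set m1 := exec_prim _ _.
have [e0 [e1 e2] eN eB eA] := @stash_primsP m1 62 isT m0 erefl.
apply: wp_seq; apply: wp_prims; first by vm_compute.
move: (foldl _ _ _) e0 e1 e2 eN eB eA => m3 e0 e1 e2 eN eB eA.
apply: wp_prims => //; rewrite /exec_prim /= e0 e2 /= addrE.
have -> : B + (16 * 62 + 0) - stride * 62 = B by rewrite /stride; lia.
split=> //; split=> //=.
- move=> x xB; case: eqP => [|_]; first by lia.
  case: eqP => [|_]; first by lia.
  case: eqP => [|_]; first by lia.
  rewrite eN; last by lia.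
  rewrite /m1 /=; case: eqP => [|_]; first by lia.
  by apply: mN; lia.
- move=> j j63; rewrite addrE addn0.
  case: eqP => [|_]; first by lia.
  case: eqP => [|_]; first by lia.
  case: eqP => [|_]; first by lia.
  case: j j63 => [|j] j63.
    by rewrite muln0 addn0 eB /m1 /=; case: eqP => [|_]; [lia|].
  have := eA j.+1; rewrite addrE addn0 => ->; last by lia.
  by apply: mN; lia.
- move=> x xB; case: eqP => [|_]; first by rewrite /stride; lia.
  by case: eqP => [|_]; [lia|rewrite m2].
- rewrite !addrE /stride; split.
    case: eqP => [|_]; first by lia.
    by case: eqP => [_|]; [rewrite m2|lia].
  case: eqP => [_|]; last by lia.
  by case: eqP => [|_]; [lia|rewrite m2].
Qed.

Definition loading j m : Prop :=
  [/\ stashed m, m.1 1 = j, m.1 2 = 64 * j, j <= n &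
   [/\ forall i, i < j -> m.1 (adr 0 i) = N0 i.+1,
       forall i, i < j -> m.2 (adr 0 i) = M0 (4 + 2 * i) &
       forall i, i < j -> m.2 (adr 1 i) = M0 (5 + 2 * i)]].

Lemma loadP m : loading 0 m ->
  wp k (While 2 0 load_point) (loading n) m.
Proof.
move=> l0; apply: (wp_while (I := loading)) => //.
  move=> j m1 [[m0 mN mA mM [mx my]] m_1 m_2 jn [lA lX lY]].
  rewrite m0 m_2 => lt; have {lt}jn1 : j < n by lia.
  split; first by lia.
  apply: wp_seq; apply: wp_prim => //; set m2 := exec_prim _ _.
  apply: wp_seq.
  pose mid m' := [/\ m'.1 0 = B, m'.1 1 = j, m'.1 2 = 64 * j,
    (forall x, 63 < x < B -> m'.1 x = N0 x) &
    (forall i, i < 63 \/ i < j.+1 -> m'.1 (adr 0 i) = N0 i.+1) /\ m'.2 = m1.2].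
  apply: (@wp_mono _ _ _ mid); last first.
    move=> m3 [e0 e1 e2 eN [eA eM]]; apply: wp_prims => //.
    rewrite /exec_prim /= e0 e1 e2 eM /stride.
    have ex : m1.2 (j + j + 4) = M0 (4 + 2 * j).
      by rewrite mM; [congr M0|]; lia.
    have ey : m1.2 (j + j + 4 + 1) = M0 (5 + 2 * j).
      by rewrite mM; [congr M0|]; lia.
    (* Storing the first coordinate does not hit the input cell of the second. *)
    have -> : (if j + j + 4 + 1 == B + j * 16 then m1.2 (j + j + 4)
        else if j + j + 4 + 1 == 0 then m1.2 (j + j + 4)
        else m1.2 (j + j + 4 + 1)) = M0 (5 + 2 * j).
      by do ?skip_cell.
    rewrite ex; split=> //=; first split=> //=.
    + by move=> x xB; do ?skip_cell; exact: eN.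
    + by move=> i i63; rewrite addrE; do ?skip_cell; rewrite -addrE eA//; left.
    + by move=> x xB; do ?skip_cell; exact: mM.
    + by rewrite !addrE; split; do ?skip_cell; rewrite -?addrE.
    + by rewrite addn1.
    + by lia.
    + split=> i ij.
      * by rewrite addrE; do ?skip_cell; rewrite -addrE eA//; right.
      * rewrite addrE; do ?skip_cell; have [->|ne] := eqVneq i j.
          by case: eqP => // h; exfalso; lia.
        by do ?skip_cell; rewrite -addrE; apply: lX; lia.
      * rewrite addrE; have [->|ne] := eqVneq i j.
          by case: eqP => // h; exfalso; lia.
        by do ?skip_cell; rewrite -addrE; apply: lY; lia.
  apply: wp_if; rewrite /holds /m2 /= m_1 => h.
    apply: wp_prims => //; rewrite /exec_prim /= m0 m_1 /stride.
    set v := (if j + 1 == 5 then j + 1 else _).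
    have -> : v = N0 (j + 1) by rewrite /v; do ?skip_cell; apply: mN; lia.
    split=> //=.
    + by do ?skip_cell.
    + by do ?skip_cell.
    + by do ?skip_cell.
    + by move=> x xB; do ?skip_cell; exact: mN.
    + split=> // i ij; rewrite addrE; have [->|ne] := eqVneq i j.
        by case: eqP => [_|]; [rewrite addn1|lia].
      do ?skip_cell; rewrite -addrE.
      by case: ij => ij; [exact: mA|apply: lA; lia].
  apply: wp_skip; split=> //=.
    by move=> x xB; skip_cell; exact: mN.
  split=> // i ij; rewrite addrE; skip_cell; rewrite -addrE; apply: mA; lia.
move=> j m1 lj; have [[m0 _ _ _ _] _ m_2 jn _] := lj.
by rewrite m0 m_2 => le; have -> // : n = j by lia.
Qed.

Lemma unloadP (out : nat -> nat) m : m.1 0 = B -> m.1 1 = n ->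
  (forall i, i < n -> m.1 (adr 0 i) = out i) ->
  wp k (Seq (Prim (NConst 2 63)) (While 2 1 unload_point))
    (fun m' => [/\ m'.1 0 = B, (forall i, i < n -> m'.1 (adr 0 i) = out i) &
       forall i, 62 < i < n -> m'.1 i.+1 = out i]) m.
Proof.
move=> m0 m1 mo; apply: wp_seq; apply: wp_prim => //.
pose I j m' := [/\ m'.1 0 = B, m'.1 1 = n, m'.1 2 = 63 + j,
  (forall i, i < n -> m'.1 (adr 0 i) = out i) &
  (forall i, 62 < i < 63 + j -> i < n -> m'.1 i.+1 = out i)].
apply: (wp_while (I := I)).
- split=> //=.
  + by move=> i iN; rewrite addrE; skip_cell; rewrite -addrE mo.
  + by move=> i; lia.
- move=> j m2 [e0 e1 e2 eo eN]; rewrite e1 e2 => jn; split; first by lia.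
  apply: wp_prims => //; rewrite /exec_prim /= e0 e2 /stride.
  set v := (if B + (63 + j) * 16 == 3 then _ else _).
  have -> : v = out (63 + j).
    rewrite /v; do ?skip_cell; rewrite -(eo (63 + j))// addrE.
    by congr (m2.1 _); lia.
  rewrite addn1; split=> //=.
  + by move=> i iN; rewrite addrE; do ?skip_cell; rewrite -addrE eo.
  + move=> i ij iN; have [->|ne] := eqVneq i (63 + j); first by rewrite eqxx.
    by do ?skip_cell; apply: eN => //; lia.
- move=> j m2 [e0 e1 e2 eo eN]; rewrite e1 e2 => jn; split=> // i iN.
  by apply: eN; lia.
Qed.

Lemma restoreP (out : nat -> nat) m : m.1 0 = B ->
  (forall i, i < n -> m.1 (adr 0 i) = out i) ->
  (forall i, 62 < i < n -> m.1 i.+1 = out i) ->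
  wp k restore (fun m' => forall i, i < n -> m'.1 i.+1 = out i) m.
Proof.
move=> m0 mo mN; apply: wp_seq; apply: wp_prims => //; set m1 := foldl _ m _.
have e0 : m1.1 0 = adr 0 62 by rewrite /m1 /= m0 addrE /stride addn0.
have eX x : 1 < x -> m1.1 x = m.1 x.
  by move=> x1; rewrite /m1 /exec_prim /=; do ?skip_cell.
have [f0 fX fA] := @restore_primsP m1 62 isT e0 erefl.
apply: wp_seq; apply: wp_prims; first by vm_compute.
move: (foldl _ _ _) f0 fX fA => m2 f0 fX fA.
apply: wp_prim => // i iN; rewrite /exec_prim /= f0; case: i iN => [|i] iN /=.
  rewrite fX ?eX; try lia.
  by rewrite -mo// addrE; congr (m.1 _); lia.
have [i62|i62] := leqP i.+1 62.
  by rewrite fA// eX ?mo// addrE; lia.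
by rewrite fX ?eX ?mN//; lia.
Qed.

End Machine.

(** * The whole program *)

Section Main.
Variables (R : realType) (n : nat) (I : instance R n).
Local Notation N0 := (nmem (initial I)).
Local Notation M0 := (rmem (initial I)).
Local Notation B := (64 * n).

Lemma enlargeP : 0 < n -> wp n.+1 enlarge (fun m' => [/\ m'.1 0 = B, m'.1 1 = 0,
  (forall x, 1 < x < B -> m'.1 x = N0 x), m'.1 B = N0 1 & m'.2 = M0]) (N0, M0).
Proof.
move=> n0; rewrite /enlarge; apply: wp_prims; first by vm_compute.
rewrite foldl_cat; set m1 := foldl _ _ (nseq _ _).
have [e0 eN eM] : [/\ m1.1 0 = B, (forall x, 0 < x -> m1.1 x = N0 x) & m1.2 = M0].
  rewrite /m1 /exec_prim; split; first by rewrite /=; lia.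
    by case=> [//|x _] /=.
  by [].
move: m1 e0 eN eM => m1 e0 eN eM; rewrite /= /exec_prim /= e0; split=> //.
- by skip_cell.
- move=> x xB; do ?skip_cell; apply: eN; lia.
- by do ?skip_cell; rewrite eqxx eN.
Qed.

Lemma initial_color (i : 'I_n) : N0 i.+1 = color I i.
Proof. by rewrite /= valK. Qed.

Lemma initial_pos (i : 'I_n) :
  M0 (4 + 2 * i) = (pos I i).1 /\ M0 (5 + 2 * i) = (pos I i).2.
Proof.
rewrite mul2n !addSn !add0n /= odd_double uphalf_double doubleK valK.
by [].
Qed.

Lemma mcs_mainP : 0 < n -> on_two_parallel_lines I ->
  wp n.+1 mcs_main
    (fun m => minimum_consistent I [set i : 'I_n | m.1 i.+1 != 0]) (N0, M0).
Proof.
move=> n_gt0 Il.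
apply: wp_seq; apply: wp_mono (enlargeP n_gt0) _ => m1 [e0 e1 eN eB eM].
apply: wp_if => [|_]; first by rewrite /= e0 e1; lia.
apply: wp_seq; apply: wp_mono (stashP n_gt0 e0 eN eB eM) _ => m2 [st2 s1 s2].
have l2 : loading n N0 M0 0 m2 by split.
apply: wp_seq; apply: wp_mono (loadP n_gt0 l2) _ => m3.
move=> [[q0 _ _ _ [qx qy]] q1 _ _ [lA lX lY]].
have bm : based n B m3 by [].
have KB : nregs <= B by rewrite /nregs; lia.
have C := cstmP (ltnSn n) KB (isT : 1 < 2) solve_fits bm.
apply: wp_seq; apply: wp_mono C _ => m4 [k4 v4].
have c4 := solve_correct Il (st := view B m3).
have {}c4 : minimum_consistent I [set i : 'I_n | narr (view B m4) aOut i != 0].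
  rewrite v4; apply: c4; split=> [i|i|i|] /=.
  - by rewrite lA// initial_color.
  - by rewrite lX//; have [] := initial_pos i.
  - by rewrite lY//; have [] := initial_pos i.
  - by rewrite qx qy.
have eo i : i < n -> m4.1 (addr B 0 i) = narr (view B m4) aOut i by [].
have b4 : m4.1 0 = B /\ m4.1 1 = n by rewrite !k4.
have [e40 e41] := b4.
have U := unloadP n_gt0 e40 e41 eo.
apply: wp_seq; apply: wp_mono U _ => m5 [e50 eo5 eN5].
apply: wp_mono (restoreP n_gt0 e50 eo5 eN5) _ => m6 e6.
by congr (minimum_consistent I _): c4; apply/setP => i; rewrite !inE e6.
Qed.

End Main.

Lemma mcs_main0P (R : realType) (I : instance R 0) :
  wp 1 mcs_main (fun m => minimum_consistent I [set i : 'I_0 | m.1 i.+1 != 0])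
    (nmem (initial I), rmem (initial I)).
Proof.
apply: wp_seq; apply: wp_prims => //; apply: wp_if => [_|].
  apply: wp_skip; split=> [[]//|S' _].
  by rewrite (leq_trans (max_card _))// card_ord.
by rewrite /holds /exec_prim /= insubF.
Qed.

Lemma computes_wp (R : realType) n (I : instance R n) k c (Q : {set 'I_n} -> Prop) :
  wp k c (fun m => Q [set i : 'I_n | m.1 i.+1 != 0])
    (nmem (initial I), rmem (initial I)) ->
  computes_within (code 0 c) I (time k c) Q.
Proof.
move=> w; have [|t [m [tk]]] := w (code 0 c) 0.
  by exists [::], [::]; rewrite cats0.
rewrite /computes_within /reaches => r q.
(* A halted state is a fixed point of [step], so the run can be padded to exactly [time k c]
   steps. *)
have stop j : iter j (step (code 0 c)) (at_pc (0 + clen c) m) =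
    at_pc (0 + clen c) m.
  elim: j => //= j ->; rewrite /step /= onth_default ?size_code//.
have -> : time k c = (time k c - t) + t by lia.
rewrite iterD.
have -> : initial I = at_pc 0 (nmem (initial I), rmem (initial I)) by [].
rewrite r stop; split=> //.
by rewrite /halted size_code.
Qed.

Local Open Scope classical_set_scope.
Local Open Scope ring_scope.

(** From [n + 1 <= 2 * n] for positive [n], the constant [w * 2 ^ d] works. *)
Lemma bigO_expn (R : realType) (T : nat -> nat) (w d : nat) :
  (forall n, T n <= w * n.+1 ^ d)%N ->
  (fun n => (T n)%:R : R^o) =O_\oo (fun n => n%:R ^+ d : R^o).
Proof.
have expn_double m : (0 < m -> m.+1 ^ d <= (2 * m) ^ d)%N.
  by case: d => // e m0; rewrite leq_exp2r//; lia.
move=> Tw; apply/eqOP; near=> C.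
have wC : (w * 2 ^ d)%:R <= C by near: C; exact: nbhs_pinfty_ge.
exists 1%N => // n /= n1.
rewrite !ger0_norm ?exprn_ge0//.
apply: (@le_trans _ _ ((w * 2 ^ d)%:R * n%:R ^+ d)).
  rewrite -natrX -natrM ler_nat; apply: leq_trans (Tw n) _.
  by rewrite -mulnA -expnMn leq_mul2l expn_double// orbT.
by rewrite ler_wpM2r ?exprn_ge0.
Unshelve. all: by end_near.
Qed.

Theorem theorem5 (R : realType) :
  exists (P : program) (T : nat -> nat),
    (fun n => (T n)%:R : R^o) =O_\oo (fun n => n%:R ^+ 6 : R^o) /\
    forall (n : nat) (I : instance R n),
      on_two_parallel_lines I ->
      computes_within P I (T n) (minimum_consistent I).
Proof.
(* The longest loops run [n + 1] times, hence [time] at [n.+1], which is positive even for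
   [n = 0]. *)
exists (code 0 mcs_main), (fun n => time n.+1 mcs_main); split.
  by apply: bigO_expn => n; rewrite -mcs_main_nesting; exact: time_le.
move=> n I Il; apply: computes_wp.
case: n I Il => [|n] I Il; first exact: mcs_main0P.
exact: mcs_mainP.
Qed.
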